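(* Let $m \ge 1$ and let $X_1, X_2, X_3, \ldots$ be independent, identically distributed, orthogonally invariant random matrices in $\mathcal{P}_m$. Let $S_1 = X_1$ and $S_{j+1} = S_j^{1/2} X_{j+1} S_j^{1/2}$ for $j \ge 1$, and for $n \ge 1$ let $$M_n = \max_{1 \le j \le n} d_R(I_m, X_j), \qquad U_n = \max_{1 \le j \le n} d_R(I_m, S_j).$$ Let $l, n_1, \ldots, n_l$ be positive integers, let $t_0, t_1, \ldots, t_l \in [0,\infty)$, put $n_\bullet = n_1 + \cdots + n_l$, and define $$\mathcal{I}_0 = \Big\{ 1 \le i \le l : [\mathbb{P}(U_n \le t_i)]^{n_i - \delta_{i1}} \le \frac{1}{n_i!} \Big\}.$$ If $n_\bullet \le n+1$, then $$\mathbb{P}\Big(U_n > (n_\bullet - 1) t_0 + (2n_1 - 1) t_1 + 2 \sum_{j=2}^l n_j t_j\Big) \le \mathbb{P}(M_n > t_0) + [\mathbb{P}(U_n \le t_1)]^{\chi(1 \notin \mathcal{I}_0)} \prod_{j \in \mathcal{I}_0} [\mathbb{P}(U_n > t_j)]^{n_j} \prod_{j \notin \mathcal{I}_0} \frac{1}{n_j!} \left(\frac{\mathbb{P}(U_n > t_j)}{\mathbb{P}(U_n \le t_j)}\right)^{n_j},$$ where the products run over indices $j \in \{1,\ldots,l\}$. Further, let $Y_{(1)} \le \cdots \le Y_{(n)}$ be the order statistics of $d_R(I_m,X_1), \ldots, d_R(I_m,X_n)$. Then the inequality can be strengthened by replacing the term $\mathbb{P}(M_n > t_0)$ on the right-hand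 side by $$\mathbb{P}\Big(\sum_{j = n - n_\bullet + 2}^n Y_{(j)} > (n_\bullet - 1) t_0\Big).$$
   Context: $\mathcal{P}_m$ is the cone of real symmetric positive definite $m \times m$ matrices, $I_m$ is the identity matrix, and $A^{1/2}$ denotes the unique positive definite square root of $A \in \mathcal{P}_m$. A random matrix $X \in \mathcal{P}_m$ is orthogonally invariant if $X$ and $kXk'$ have the same distribution for every $k$ in the orthogonal group $O(m)$. The Riemannian metric on $\mathcal{P}_m$ is $d_R(A,B) = \big(\sum_{j=1}^m [\log \lambda_j(A^{-1/2} B A^{-1/2})]^2\big)^{1/2}$, where $\lambda_1(\cdot),\ldots,\lambda_m(\cdot)$ denote eigenvalues. $\delta_{ij}$ is Kronecker's delta, and $\chi(\mathscr{S})$ equals $1$ if the statement $\mathscr{S}$ holds and $0$ otherwise. Empty products equal $1$, empty sums equal $0$, and $0^0 = 1$. *)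

(* Defs.v *)
From mathcomp Require Export all_boot all_order all_algebra.
From mathcomp Require Export all_classical all_reals all_analysis.

Set Implicit Arguments.
Unset Strict Implicit.
Unset Printing Implicit Defensive.

Export Order.TTheory GRing.Theory Num.Theory numFieldNormedType.Exports.

Local Open Scope classical_set_scope.
Local Open Scope ring_scope.

Definition posdefmx (R : realType) (m : nat) (A : 'M[R]_m) : Prop :=
  A^T = A /\ forall x : 'cV[R]_m, x != 0 -> 0 < (x^T *m A *m x) ord0 ord0.

Definition orthomx (R : realType) (m : nat) (k : 'M[R]_m) : Prop :=
  k *m k^T = 1%:M.

(* The positive definite B with B^2 = A; it exists and is unique when A is
   positive definite, and the value is irrelevant otherwise. *)
Definition sqrtmx (R : realType) (m : nat) (A : 'M[R]_m) : 'M[R]_m :=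
  get [set B : 'M[R]_m | posdefmx B /\ B *m B = A].

(* The eigenvalues with multiplicity, in an unspecified order; the sequence is
   a junk value when char_poly A does not split over R, which does not happen
   for a symmetric A. *)
Definition eigenvals (R : realType) (m : nat) (A : 'M[R]_m) : seq R :=
  xget [::] [set s : seq R | char_poly A = \prod_(a <- s) ('X - a%:P)].

Definition dR (R : realType) (m : nat) (A B : 'M[R]_m) : R :=
  let C := invmx (sqrtmx A) *m B *m invmx (sqrtmx A) in
  Num.sqrt (\sum_(a <- eigenvals C) ln a ^+ 2).

(* Square matrices with their Borel sigma-algebra. *)
Definition borelmx (R : realType) (m : nat) : measurableType _ :=
  g_sigma_algebraType (@open 'M[R]_m).

Definition Pr (d : measure_display) (T : measurableType d) (R : realType)
    (P : probability T R) (E : set T) : R := fine (P E).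

Definition mutually_independent (d d' : measure_display)
    (T : measurableType d) (T' : measurableType d') (R : realType)
    (P : probability T R) (X : nat -> {RV P >-> T'}) : Prop :=
  forall (J : seq nat) (B : nat -> set T'),
    uniq J -> (forall i, measurable (B i)) ->
    Pr P (\bigcap_(i in [set` J]) (X i @^-1` B i)) =
    \prod_(i <- J) Pr P (X i @^-1` B i).

(* Laws are compared on measurable sets only: the library's measures are total
   functions, unconstrained on the other sets. *)
Definition identically_distributed (d d' : measure_display)
    (T : measurableType d) (T' : measurableType d') (R : realType)
    (P : probability T R) (X : nat -> {RV P >-> T'}) : Prop :=
  forall (i j : nat) (B : set T'),
    measurable B -> P (X i @^-1` B) = P (X j @^-1` B).

Definition orthogonally_invariant (d : measure_display) (T : measurableType d)
    (R : realType) (P : probability T R) (m : nat)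
    (X : {RV P >-> borelmx R m}) : Prop :=
  forall k : 'M[R]_m, orthomx k ->
  forall B : set (borelmx R m), measurable B ->
    P [set w | B (k *m (X w : 'M[R]_m) *m k^T)] = P [set w | B (X w)].

(* In the three definitions below the sequence x is indexed from 0, so that
   x j and walk x j stand for X_(j+1) and S_(j+1). *)
Fixpoint walk (R : realType) (m : nat) (x : nat -> 'M[R]_m) (j : nat) :
    'M[R]_m :=
  if j is i.+1 then sqrtmx (walk x i) *m x i.+1 *m sqrtmx (walk x i)
  else x 0%N.

(* The maximum is taken with 0, which changes nothing as dR >= 0. *)
Definition maxdist (R : realType) (m : nat) (x : nat -> 'M[R]_m) (n : nat) :
    R := \big[Order.max/0]_(0 <= j < n) dR 1%:M (x j).

Definition dists (R : realType) (m : nat) (x : nat -> 'M[R]_m) (n : nat) :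
    seq R := [seq dR 1%:M (x j) | j <- iota 0 n].

(* The j-th smallest entry of s, for 1 <= j <= size s. *)
Definition order_stat (R : realType) (s : seq R) (j : nat) : R :=
  nth 0 (sort <=%R s) j.-1.

(* Main.v *)
Require Import Defs.
From mathcomp Require Import ring lra zify measurable_realfun.

Set Implicit Arguments.
Unset Strict Implicit.
Unset Printing Implicit Defensive.

Local Open Scope classical_set_scope.
Local Open Scope ring_scope.

(* The increments of the walk are not independent, but S_j = Z_j Z_j^T where
   Z_j = g_1 ... g_j, g_i is the square root of X'_i = k_i X_i k_i^T, and the
   orthogonal matrix k_i is a function of X_1, ..., X_(i-1) only.  Orthogonal
   invariance makes the X'_i independent, and d_R(I, X'_i) = d_R(I, X_i).  As
   g |-> d_R(I, g g^T) is invariant under inversion and subadditive on GL_m (by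
   log-majorization of eigenvalues), this is a random walk on a group with a
   length function, and the Hoffmann-Jorgensen argument applies.

   Consider n_bullet successive stopping times, each being the first time at
   which the walk has moved from its previous stopping position by more than
   the current threshold: t_1 once, then 2 t_j.  If they do not all occur by
   time n, the walk stays within the sum of the thresholds plus at most
   n_bullet - 1 distinct jumps.  If they do, condition on the successive
   positions.  With H k = P (U_k > t), an increment starting at time k satisfies
     P (it exceeds 2t by time K) (1 - H k) <= H K - H k,
   which bounds the probability of a further stopping time by P (U_n > t), and,
   after an Abel summation along n_j stopping times, bounds that of the whole
   block by (P (U_n > t) / P (U_n <= t))^n_j / n_j!. *)

(** * Spectral theory of real symmetric matrices *)

(** The thresholds are doubled because a move between two unknown positions is compared with their
    distances from the identity: a move of more than 2t puts one of its ends outside the ball of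
    radius t. The first move starts at the identity, so t_1 is enough there, whence 2 n_1 - 1. A
    chain that fails has reached at most n_bullet - 1 stopping times, and each of these is charged
    one jump.

    Write u = P (U_n > t_j). A block admits two bounds, u^n_j and (u / (1 - u))^n_j / n_j!, and I_0
    selects the smaller one. In the first block the second bound gains a factor 1 - u, since the
    first stopping time has the increments of H as its law, without division by 1 - u; this is why
    delta_i1 enters the exponent that defines I_0.

    Measurability is an obstacle of its own: the square root and the list of eigenvalues are picked
    by a choice operator, which says nothing about how they vary with the matrix. The square root is
    recovered as a pointwise limit of rational functions of the entries, and the distance as a limit
    of expressions in iterated square roots. *)

Section Spectral.
Variable R : realType.

Definition dotr n (u v : 'rV[R]_n) : R := (u *m v^T) 0 0.

Lemma dotrE n (u v : 'rV[R]_n) : dotr u v = \sum_i u 0 i * v 0 i.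
Proof. by rewrite /dotr mxE; apply: eq_bigr => i _; rewrite mxE. Qed.

Lemma dotrC n (u v : 'rV[R]_n) : dotr u v = dotr v u.
Proof. by rewrite !dotrE; apply: eq_bigr => i _; rewrite mulrC. Qed.

Lemma dotrDl n (u v w : 'rV[R]_n) : dotr (u + v) w = dotr u w + dotr v w.
Proof. by rewrite /dotr mulmxDl mxE. Qed.

Lemma dotrZl n (a : R) (u w : 'rV[R]_n) : dotr (a *: u) w = a * dotr u w.
Proof. by rewrite /dotr -scalemxAl mxE. Qed.

Lemma dotrDr n (u v w : 'rV[R]_n) : dotr w (u + v) = dotr w u + dotr w v.
Proof. by rewrite dotrC dotrDl !(dotrC w). Qed.

Lemma dotrZr n (a : R) (u w : 'rV[R]_n) : dotr w (a *: u) = a * dotr w u.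
Proof. by rewrite dotrC dotrZl dotrC. Qed.

Lemma dotrBl n (u v w : 'rV[R]_n) : dotr (u - v) w = dotr u w - dotr v w.
Proof. by rewrite dotrDl -scaleN1r dotrZl mulN1r. Qed.

Lemma dotrBr n (u v w : 'rV[R]_n) : dotr w (u - v) = dotr w u - dotr w v.
Proof. by rewrite dotrC dotrBl !(dotrC w). Qed.

Lemma dotrM n p (A : 'M[R]_(n, p)) u v : dotr (u *m A) v = dotr u (v *m A^T).
Proof. by rewrite /dotr trmx_mul trmxK mulmxA. Qed.

Lemma dotr_ge0 n (u : 'rV[R]_n) : 0 <= dotr u u.
Proof. by rewrite dotrE; apply: sumr_ge0 => i _; rewrite -expr2 sqr_ge0. Qed.

Lemma dotr_eq0 n (u : 'rV[R]_n) : (dotr u u == 0) = (u == 0).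
Proof.
apply/eqP/eqP => [|->]; last by rewrite /dotr mul0mx mxE.
rewrite dotrE => /psumr_eq0P u0; apply/rowP => i; rewrite mxE.
have /eqP := u0 (fun i _ => sqr_ge0 (u 0 i)) i isT.
by rewrite mulf_eq0 orbb => /eqP.
Qed.

Lemma dotr_gt0 n (u : 'rV[R]_n) : (0 < dotr u u) = (u != 0).
Proof. by rewrite lt0r dotr_ge0 andbT dotr_eq0. Qed.

Lemma dotr_row n p q (A : 'M[R]_(n, q)) (B : 'M[R]_(p, q)) i j :
  dotr (row i A) (row j B) = (A *m B^T) i j.
Proof.
rewrite dotrE mxE; apply: eq_bigr => k _; by rewrite !mxE.
Qed.

(* The reflection in the hyperplane orthogonal to v - u exchanges u and v. *)
Lemma householder n (u v : 'rV[R]_n) : dotr u u = dotr v v ->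
  exists H : 'M[R]_n, [/\ H^T = H, H *m H = 1%:M, u *m H = v & v *m H = u].
Proof.
move=> uv; have [->|neq] := eqVneq u v.
  by exists 1%:M; rewrite trmx1 !mulmx1.
pose w := v - u; have w0 : dotr w w != 0 by rewrite dotr_eq0 subr_eq0 eq_sym.
have wM : w^T *m w *m (w^T *m w) = dotr w w *: (w^T *m w).
  rewrite mulmxA -(mulmxA w^T) [w *m w^T]mx11_scalar.
  by rewrite mul_mx_scalar -scalemxAl.
have Hx x : x *m (1%:M - (2 / dotr w w) *: (w^T *m w)) =
    x - (2 / dotr w w * dotr x w) *: w.
  rewrite mulmxBr mulmx1 -scalemxAr mulmxA [x *m w^T]mx11_scalar mul_scalar_mx.
  by rewrite scalerA.
have ww : dotr w w = 2 * dotr u u - 2 * dotr u v.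
  rewrite /w dotrBl !dotrBr -uv (dotrC v u); ring.
have uw : dotr u w = - (dotr w w / 2).
  rewrite ww /w dotrBr; by field.
have vw : dotr v w = dotr w w / 2.
  rewrite ww /w dotrBr -uv (dotrC v u); by field.
exists (1%:M - (2 / dotr w w) *: (w^T *m w)); split.
- by rewrite linearB linearZ /= trmx1 trmx_mul trmxK.
- rewrite mulmxBr mulmx1 mulmxBl mul1mx -scalemxAl -scalemxAr wM !scalerA.
  rewrite -addrA -opprD -[RHS]subr0; congr (_ - _).
  rewrite -scalerBl -scalerDl (_ : _ + _ = 0) ?scale0r //; by field.
- rewrite Hx uw (_ : _ * _ = -1); last by field.
  by rewrite scaleN1r opprK /w addrC subrK.
- rewrite Hx vw (_ : _ * _ = 1); last by field.
  by rewrite scale1r /w opprB addrC subrK.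
Qed.

Lemma continuous_dotr_mul n (A : 'M[R]_n) :
  continuous (fun v : 'rV[R]_n => dotr (v *m A) v).
Proof.
move=> v; rewrite (_ : (fun _ => _) = fun v : 'rV[R]_n =>
   \sum_j (\sum_i v 0 i * A i j) * v 0 j); last first.
  by apply/funext => w; rewrite dotrE; apply: eq_bigr => j _; rewrite mxE.
apply: (@continuous_big _ _ +%R 0) => [|j _ w]; first exact: add_continuous.
apply: continuousM; last exact: coord_continuous.
apply: (@continuous_big _ _ +%R 0) => [|i _ z]; first exact: add_continuous.
by apply: continuousM; [exact: coord_continuous|exact: cst_continuous].
Qed.

(** The quadratic form attains its maximum on the compact unit sphere, and first-order optimality at
    the maximizer is the eigenvector equation. *)
Lemma rayleigh_max n (A : 'M[R]_n.+1) : A^T = A ->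
  exists (v : 'rV[R]_n.+1) (a : R), [/\ dotr v v = 1, v *m A = a *: v &
    forall u, dotr (u *m A) u <= a * dotr u u].
Proof.
move=> As; pose S := [set v : 'rV[R]_n.+1 | dotr v v = 1].
have S0 : S !=set0.
  exists (delta_mx 0 0); rewrite /S /= dotrE (bigD1 0) //= big1 ?addr0.
    by rewrite mxE eqxx mulr1.
  by move=> i i0; rewrite mxE eqxx (negbTE i0) mulr0.
have cS : compact S.
  have cube : compact [set v : 'rV[R]_n.+1 | forall i, v ord0 i \in `[-1, 1]].
    apply: (@rV_compact _ _ (fun=> `[(-1 : R), 1]%classic)) => _.
    exact: segment_compact.
  apply: subclosed_compact cube _ => [|v /= vv i]; last first.
    rewrite in_itv /= -ler_norml -(@expr_le1 _ 2) // -normrX.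
    rewrite ger0_norm ?sqr_ge0 // -vv dotrE (bigD1 i) //= expr2 lerDl.
    by apply: sumr_ge0 => k _; rewrite -expr2 sqr_ge0.
  rewrite (_ : S = (fun v => dotr (v *m 1%:M) v) @^-1` [set 1]); last first.
    by apply/seteqP; split=> v /=; rewrite /S /= mulmx1.
  apply: closed_comp; last exact: closed_eq.
  by move=> v _; apply: continuous_dotr_mul.
have [v Sv vmax] := EVT_max_rV S0 cS
  (continuous_subspaceT (continuous_dotr_mul (A := A))).
rewrite inE /S /= in Sv.
pose a := dotr (v *m A) v.
have ray u : dotr (u *m A) u <= a * dotr u u.
  have [->|u0] := eqVneq u 0; first by rewrite mul0mx /dotr mul0mx mxE mulr0.
  have uu : 0 < dotr u u by rewrite dotr_gt0.
  have su : Num.sqrt (dotr u u) ^+ 2 = dotr u u by rewrite sqr_sqrtr// ltW.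
  have su0 : Num.sqrt (dotr u u) != 0 by rewrite sqrtr_eq0 -ltNge.
  have /vmax : (Num.sqrt (dotr u u))^-1 *: u \in S.
    by rewrite inE /S /= dotrZl dotrZr -{3}su; by field.
  rewrite -scalemxAl dotrZl dotrZr mulrA -expr2 exprVn su mulrC.
  by rewrite ler_pdivrMr.
exists v, a; split=> //.
(* Moving [v] to [v + s *: w] in the Rayleigh inequality gives [0 <= 2 * s * b + s ^+ 2 * q] for
   every [s], which forces [b = 0]: take [s = b] and [s = - b] if [q = 0], and the minimizer
   [s = - b / q] otherwise. *)
have orth w : dotr (a *: v - v *m A) w = 0.
  set b := dotr _ w; pose q := a * dotr w w - dotr (w *m A) w.
  have q0 : 0 <= q by rewrite subr_ge0.
  have key s : 0 <= 2 * s * b + s ^+ 2 * q.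
    have := ray (v + s *: w); rewrite -subr_ge0; congr (0 <= _).
    rewrite mulmxDl -scalemxAl !dotrDl !dotrDr !dotrZl !dotrZr Sv -/a.
    rewrite (dotrC w v) /b /q dotrBl !dotrZl (dotrM A w v) As.
    rewrite (dotrC w (v *m A)); ring.
  apply/eqP; case: (eqVneq q 0) => [q00|qn0].
    have := key b; have := key (- b); rewrite q00 !mulr0 !addr0 => h1 h2.
    by rewrite -sqrf_eq0; apply/eqP; nra.
  have qp : 0 < q by rewrite lt0r qn0.
  have := key (- b / q).
  rewrite (_ : _ + _ = - (b ^+ 2 / q)); last by field.
  rewrite oppr_ge0 => h.
  rewrite -sqrf_eq0 eq_le sqr_ge0 andbT.
  by rewrite -(pmulr_lle0 _ (_ : 0 < q^-1)) ?invr_gt0 // mulrC.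
by move/eqP: (orth (a *: v - v *m A)); rewrite dotr_eq0 subr_eq0 => /eqP.
Qed.

Lemma diag_mxE n (d : 'rV[R]_n) i : diag_mx d i i = d 0 i.
Proof. by rewrite mxE eqxx. Qed.

(** Deflation by an eigenvector of the largest eigenvalue: a Householder reflection carries it to
    the first basis vector, and symmetry makes the reflected matrix block diagonal. Extracting the
    largest eigenvalue each time yields the decreasing order on which majorization relies. *)
Lemma spectral n (A : 'M[R]_n) : A^T = A ->
  exists (O : 'M[R]_n) (d : 'rV[R]_n), [/\ O *m O^T = 1%:M,
    A = O^T *m diag_mx d *m O & forall i j : 'I_n, (i <= j)%N -> d 0 j <= d 0 i].
Proof.
elim: n A => [|n IHn] A As.
  exists 1%:M, 0; split => [| |[]//]; last by apply/matrixP => -[].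
  by rewrite trmx1 mulmx1.
have [v [a [vv vA ray]]] := rayleigh_max As.
pose e : 'rV[R]_(1 + n) := delta_mx 0 0.
have ee : dotr e e = 1.
  rewrite dotrE (bigD1 0) //= big1 ?addr0 => [|i i0].
    by rewrite mxE eqxx mulr1.
  by rewrite mxE eqxx (negbTE i0) mulr0.
have [H [HT HH eH vH]] : exists H : 'M[R]_(1 + n),
    [/\ H^T = H, H *m H = 1%:M, e *m H = v & v *m H = e].
  by apply: householder; rewrite ee vv.
have [B BE] : {B : 'M[R]_(1 + n) | B = H *m A *m H} by exists (H *m A *m H).
have BT : B^T = B by rewrite BE !trmx_mul HT As mulmxA.
have eB : e *m B = a *: e.
  by rewrite BE !mulmxA eH vA -scalemxAl vH.
have B0 (i j : 'I_(1 + n)) : i = 0%N :> nat -> B i j = a * (j == 0%N :> nat)%:R.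
  move=> i0; have -> : i = 0 by apply: val_inj.
  have := congr1 (fun M : 'rV_(1 + n) => M 0 j) eB.
  by rewrite -rowE !mxE eqxx.
have Bul : ulsubmx B = a%:M.
  by apply/matrixP => i j; rewrite !ord1 !mxE B0 ?mulr1.
have Bur : ursubmx B = 0.
  by apply/matrixP => i j; rewrite !ord1 !mxE B0 ?mulr0.
have Bdl : dlsubmx B = 0.
  by apply/matrixP => i j; rewrite !ord1 !mxE -BT mxE B0 ?mulr0.
have [ O [d [OO OA dsort]]] : exists (O : 'M[R]_n) (d : 'rV[R]_n),
    [/\ O *m O^T = 1%:M, drsubmx B = O^T *m diag_mx d *m O &
    forall i j : 'I_n, (i <= j)%N -> d 0 j <= d 0 i].
  by apply: IHn; rewrite trmx_drsub BT.
pose O' : 'M[R]_(1 + n) := block_mx 1%:M 0 0 O *m H.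
pose d' : 'rV[R]_(1 + n) := row_mx a%:M d.
have OO' : O' *m O'^T = 1%:M.
  rewrite /O' trmx_mul HT mulmxA -(mulmxA _ H H) HH mulmx1 tr_block_mx.
  rewrite !trmx0 trmx1 mulmx_block !mulmx0 !mul0mx !mulmx1 !addr0 add0r OO.
  by rewrite -scalar_mx_block.
have Adef : A = O'^T *m diag_mx d' *m O'.
  rewrite /O' /d' trmx_mul HT diag_mx_row tr_block_mx !trmx0 trmx1.
  have -> : diag_mx (a%:M : 'rV_1) = a%:M :> 'M[R]_1.
    by apply/matrixP => i j; rewrite !ord1 !mxE.
  rewrite !mulmxA -(mulmxA H) mulmx_block !mulmx0 !mul0mx !mul1mx !addr0 !add0r.
  rewrite -(mulmxA H) mulmx_block !mulmx0 !mul0mx !mulmx1 !addr0 !add0r -OA.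
  rewrite -Bul -{1}Bur -Bdl submxK BE !mulmxA HH mul1mx.
  by rewrite -mulmxA HH mulmx1.
clearbody O'; exists O', d'; split => // i j.
(* Each entry of [d'] is the Rayleigh quotient of [A] at a row of [O'], hence at most the maximum
   [a]. *)
have le_a k : d' 0 k <= a.
  have := ray (row k O').
  have -> : dotr (row k O' *m A) (row k O') = d' 0 k.
    rewrite -row_mul dotr_row Adef !mulmxA OO' mul1mx -mulmxA OO' mulmx1.
    by rewrite diag_mxE.
  by rewrite dotr_row OO' [1%:M _ _]mxE eqxx mulr1.
case: (split_ordP (i : 'I_(1 + n))) => i' ->.
  have -> : d' 0 (lshift n i') = a by rewrite row_mxEl ord1 mxE.
  by rewrite le_a.
case: (split_ordP (j : 'I_(1 + n))) => j' ->; first by rewrite ord1.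
have d'r k : d' 0 (rshift 1 k) = d 0 k by rewrite row_mxEr.
by rewrite leq_add2l => /dsort; rewrite -(d'r i') -(d'r j').
Qed.

Lemma char_poly_conj n (P A : 'M[R]_n) : P \in unitmx ->
  char_poly (P *m A *m invmx P) = char_poly A.
Proof.
move=> Pu; rewrite /char_poly /char_poly_mx.
have PX : map_mx polyC P *m map_mx polyC (invmx P) = 1%:M.
  by rewrite -map_mxM mulmxV // map_mx1.
have -> : 'X%:M - map_mx polyC (P *m A *m invmx P) =
  map_mx polyC P *m ('X%:M - map_mx polyC A) *m map_mx polyC (invmx P).
  rewrite mulmxBr mulmxBl !map_mxM; congr (_ - _).
  by rewrite scalar_mxC -mulmxA PX mulmx1.
by rewrite !det_mulmx mulrAC -det_mulmx PX det1 mul1r.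
Qed.

Lemma orthomx_unit n (O : 'M[R]_n) : orthomx O -> O \in unitmx.
Proof. by move=> OO; have [] := mulmx1_unit OO. Qed.

Lemma orthomxC n (O : 'M[R]_n) : orthomx O -> O^T *m O = 1%:M.
Proof. exact: mulmx1C. Qed.

Lemma orthomx_tr n (O : 'M[R]_n) : orthomx O -> orthomx O^T.
Proof. by move=> OO; rewrite /orthomx trmxK orthomxC. Qed.

Lemma orthomx_inv n (O : 'M[R]_n) : orthomx O -> invmx O = O^T.
Proof.
move=> OO; have Ou := orthomx_unit OO.
by rewrite -[LHS]mulmx1 -OO mulmxA mulVmx // mul1mx.
Qed.

Lemma char_poly_orth n (O A : 'M[R]_n) : orthomx O ->
  char_poly (O *m A *m O^T) = char_poly A.
Proof. by move=> OO; rewrite -orthomx_inv // char_poly_conj // orthomx_unit. Qed.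

Lemma char_poly_diag n (O : 'M[R]_n) d : orthomx O ->
  char_poly (O^T *m diag_mx d *m O) = \prod_i ('X - (d 0 i)%:P).
Proof.
move=> OO; have := @char_poly_orth n O^T (diag_mx d); rewrite trmxK => ->.
  2: exact: orthomx_tr.
rewrite char_poly_trig ?diag_mx_is_trig //.
by apply: eq_bigr => i _; rewrite mxE eqxx.
Qed.

Lemma posdefmxP n (A : 'M[R]_n) : posdefmx A <->
  A^T = A /\ forall v : 'rV[R]_n, v != 0 -> 0 < dotr (v *m A) v.
Proof.
split=> -[AT Ap]; split=> // x x0.
  by have := Ap x^T; rewrite trmxK; apply; rewrite trmx_eq0.
by have := Ap x^T; rewrite trmx_eq0 /dotr trmxK; apply.
Qed.

Lemma posdef_diag n (O : 'M[R]_n) d : orthomx O ->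
  posdefmx (O^T *m diag_mx d *m O) <-> forall i, 0 < d 0 i.
Proof.
move=> OO; rewrite posdefmxP; split=> [[_ Ap] i|dp].
  have := Ap (row i O); rewrite -!row_mul dotr_row.
  rewrite !mulmxA OO mul1mx -mulmxA OO mulmx1 mxE eqxx mulr1n; apply.
  apply: contraTneq (oner_neq0 R) => r0; rewrite negbK; apply/eqP.
  have <- : (O *m O^T) i i = 1 by rewrite OO mxE eqxx.
  by rewrite -dotr_row r0 /dotr mul0mx mxE.
split=> [|v v0]; first by rewrite !trmx_mul trmxK tr_diag_mx mulmxA.
rewrite mulmxA dotrM mulmxA.
set w := v *m O^T; have w0 : w != 0.
  apply: contraNneq v0 => w0; rewrite -[v]mulmx1 -(orthomxC OO) mulmxA -/w.
  by rewrite w0 mul0mx.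
have -> : dotr (w *m diag_mx d) w = \sum_i d 0 i * w 0 i ^+ 2.
  rewrite dotrE; apply: eq_bigr => i _.
  by rewrite mul_mx_diag mxE (mulrC (w 0 i)) -mulrA expr2.
have [i wi] : exists i, w 0 i != 0.
  apply/existsP; apply: contraNT w0 => /existsPn w0.
  by apply/eqP/rowP => i; rewrite [RHS]mxE; apply/eqP/negbNE/w0.
rewrite (bigD1 i) //= ltr_pwDl //.
  by rewrite mulr_gt0 // lt0r sqrf_eq0 wi sqr_ge0.
by apply: sumr_ge0 => j _; rewrite mulr_ge0 ?sqr_ge0 // ltW.
Qed.

Lemma posdef1 n : posdefmx (1%:M : 'M[R]_n).
Proof.
have := @posdef_diag n 1%:M (const_mx 1).
rewrite /orthomx trmx1 mulmx1 mul1mx diag_const_mx mulmx1 => /(_ erefl) [_].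
by apply=> i; rewrite mxE.
Qed.

Lemma posdef_spectral n (A : 'M[R]_n) : posdefmx A ->
  exists (O : 'M[R]_n) (d : 'rV[R]_n), [/\ orthomx O,
    A = O^T *m diag_mx d *m O, forall i, 0 < d 0 i &
    forall i j : 'I_n, (i <= j)%N -> d 0 j <= d 0 i].
Proof.
move=> Ap; have [AT _] := Ap; have [ O [d [OO Ad ds]]] := spectral AT.
exists O, d; split=> //; by apply/(posdef_diag d OO); rewrite -Ad.
Qed.

Lemma orth_diagM n (O : 'M[R]_n) (d e : 'rV[R]_n) : orthomx O ->
  (O^T *m diag_mx d *m O) *m (O^T *m diag_mx e *m O) =
  O^T *m diag_mx (\row_i (d 0 i * e 0 i)) *m O.
Proof.
move=> OO; rewrite !mulmxA -[_ *m O *m O^T]mulmxA OO mulmx1 -[X in X *m O]mulmxA.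
rewrite mulmx_diag; congr (_ *m diag_mx _ *m _).
Qed.

Lemma sqrtmxP n (A : 'M[R]_n) : posdefmx A ->
  posdefmx (sqrtmx A) /\ sqrtmx A *m sqrtmx A = A.
Proof.
move=> /posdef_spectral [ O [d [OO Ad dp _]]]; rewrite /sqrtmx.
pose e := \row_i Num.sqrt (d 0 i).
apply: (@getPex _ [set B : 'M[R]_n | posdefmx B /\ B *m B = A]).
exists (O^T *m diag_mx e *m O); split.
  by apply/posdef_diag => // i; rewrite mxE sqrtr_gt0.
rewrite orth_diagM // Ad; congr (_ *m diag_mx _ *m _).
by apply/rowP => i; rewrite !mxE -expr2 sqr_sqrtr // ltW.
Qed.

Lemma posdef_unit n (A : 'M[R]_n) : posdefmx A -> A \in unitmx.
Proof.
move=> /posdef_spectral [ O [d [OO -> dp _]]].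
rewrite !unitmx_mul unitmx_tr orthomx_unit // andbT unitmxE det_diag unitfE.
by apply/prodf_neq0 => i _; rewrite gt_eqF.
Qed.

Lemma posdefD n (A B : 'M[R]_n) : posdefmx A -> posdefmx B -> posdefmx (A + B).
Proof.
move=> /posdefmxP [AT Ap] /posdefmxP [BT Bp]; apply/posdefmxP; split.
  by rewrite linearD /= AT BT.
by move=> v v0; rewrite mulmxDr dotrDl addr_gt0 ?Ap ?Bp.
Qed.

(** The choice only provides some positive definite [B] with [B *m B = 1%:M]. Then (B - 1)(B + 1) =
    0, and B + 1 is positive definite, hence invertible. *)
Lemma sqrtmx1 n : sqrtmx 1%:M = 1%:M :> 'M[R]_n.
Proof.
have [Bp BB] := sqrtmxP (posdef1 n); set B := sqrtmx _ in Bp BB *.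
have u : B + 1%:M \in unitmx by apply: posdef_unit; apply: posdefD => //; exact: posdef1.
apply/eqP; rewrite -subr_eq0 -[B - _](mulmxK u) mulmxDr mulmxBl BB mulmx1 mul1mx.
by rewrite addrA subrK subrr mul0mx.
Qed.

(** Two factorizations into monic linear factors agree up to order, so the list picked by
    [eigenvals] is a permutation of [s], and the sum ignores the order. *)
Lemma dR1_roots n (A : 'M[R]_n) (s : seq R) :
  char_poly A = \prod_(a <- s) ('X - a%:P) ->
  dR 1%:M A = Num.sqrt (\sum_(a <- s) ln a ^+ 2).
Proof.
move=> As; rewrite /dR sqrtmx1 invmx1 mul1mx mulmx1 /eigenvals.
case: xgetP => [t _ /= /esym|/(_ s)]; last by [].
by rewrite As => /prod_XsubC_eq st; congr Num.sqrt; apply: perm_big.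
Qed.

Lemma posdef_congr n (A g : 'M[R]_n) : posdefmx A -> g \in unitmx ->
  posdefmx (g *m A *m g^T).
Proof.
move=> /posdefmxP [AT Ap] gu; apply/posdefmxP; split.
  by rewrite !trmx_mul trmxK AT mulmxA.
move=> v v0; rewrite !mulmxA dotrM trmxK; apply: Ap.
by apply: contraNneq v0 => vg; rewrite -[v](mulmxK gu) vg mul0mx.
Qed.

Lemma posdef_gram n (g : 'M[R]_n) : g \in unitmx -> posdefmx (g *m g^T).
Proof. by move=> gu; rewrite -[g in g *m _]mulmx1; apply: posdef_congr (posdef1 n) gu. Qed.

Lemma dR1_ge0 n (A : 'M[R]_n) : 0 <= dR 1%:M A.
Proof. exact: sqrtr_ge0. Qed.

Lemma dR1_diag n (O : 'M[R]_n) d : orthomx O ->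
  dR 1%:M (O^T *m diag_mx d *m O) = Num.sqrt (\sum_i ln (d 0 i) ^+ 2).
Proof.
move=> OO; rewrite (@dR1_roots _ _ [seq d 0 i | i : 'I_n]).
  by rewrite big_map big_enum.
by rewrite char_poly_diag // big_map big_enum.
Qed.

Lemma dR1_char_poly n (A B : 'M[R]_n) : char_poly A = char_poly B ->
  dR 1%:M A = dR 1%:M B.
Proof.
by move=> AB; rewrite /dR sqrtmx1 invmx1 !mul1mx !mulmx1 /eigenvals AB.
Qed.

End Spectral.

(** * The triangle inequality on positive definite matrices *)

Section Triangle.
Variable R : realType.

Lemma dotr_diag n (d v : 'rV[R]_n) :
  dotr (v *m diag_mx d) v = \sum_i d 0 i * v 0 i ^+ 2.
Proof.
rewrite dotrE; apply: eq_bigr => i _.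
by rewrite mul_mx_diag mxE (mulrC (v 0 i)) -mulrA expr2.
Qed.

Lemma exists_kernel_row n p (G : 'M[R]_(n, p)) : (p < n)%N ->
  exists2 c : 'rV[R]_n, c != 0 & c *m G = 0.
Proof.
move=> pn; have : kermx G != 0.
  rewrite kermx_eq0 /row_free neq_ltn.
  by rewrite (leq_ltn_trans (rank_leq_col G) pn).
by move=> /rowV0Pn [c /sub_kermxP cG c0]; exists c.
Qed.

(* The span of the first i + 1 rows of V meets the span of the eigenvectors
   number i, i + 1, ... of N. *)
Lemma compression_eigenvalue_le n k (V : 'M[R]_(k, n.+1)) (O : 'M[R]_n.+1)
    (a : 'rV[R]_n.+1) (mu : 'rV[R]_k) : orthomx O -> V *m V^T = 1%:M ->
  V *m (O^T *m diag_mx a *m O) *m V^T = diag_mx mu ->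
  (forall i j : 'I_n.+1, (i <= j)%N -> a 0 j <= a 0 i) ->
  (forall i j : 'I_k, (i <= j)%N -> mu 0 j <= mu 0 i) -> (k <= n.+1)%N ->
  forall i : 'I_k, mu 0 i <= a 0 (inord i).
Proof.
case: k V mu => [V mu _ _ _ _ _ _ []//|k V mu] OO VV VNV adec mudec kn i.
(* The columns of [G] are [k] linear conditions on [k.+1] coefficients [c]: the first [i] make
   [c *m V] orthogonal to the eigenvectors before [i], the others annihilate the coefficients of [c]
   after [i]. One unknown more than equations leaves a nonzero solution. *)
pose G : 'M[R]_(k.+1, k) := \matrix_(j, q)
  if (q < i)%N then (V *m O^T) j (inord q) else (j == q.+1 :> nat)%:R.
have [c c0 cG] := exists_kernel_row G (ltnSn k).
have c_small (j : 'I_k.+1) : (i < j)%N -> c 0 j = 0.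
  move=> ij; have jk : (j.-1 < k)%N by have := ltn_ord j; lia.
  have /rowP/(_ (Ordinal jk)) := cG; rewrite !mxE (bigD1 j) //= big1.
    rewrite addr0 mxE /= ifF; last by apply/negbTE; lia.
    by rewrite prednK ?eqxx ?mulr1 //; lia.
  move=> q qj; rewrite mxE /= ifF; last by apply/negbTE; lia.
  rewrite prednK; last by lia.
  by rewrite -val_eqE /= in qj; rewrite (negbTE qj) mulr0.
pose v := c *m V; pose u := v *m O^T.
have u_small (j : 'I_n.+1) : (j < i)%N -> u 0 j = 0.
  move=> ji; have jk : (j < k)%N by have := ltn_ord i; lia.
  transitivity ((c *m G) 0 (Ordinal jk)); last by rewrite cG mxE.
  rewrite /u /v -mulmxA mxE [RHS]mxE; apply: eq_bigr => q _; congr (_ * _).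
  by rewrite [RHS]mxE /= ji; congr (_ _ _); apply: val_inj; rewrite /= inordK.
have uu : dotr u u = dotr c c.
  rewrite /u dotrM trmxK -(mulmxA v) orthomxC // mulmx1.
  by rewrite /v dotrM -(mulmxA c) VV mulmx1.
have N1 : dotr (u *m diag_mx a) u = dotr (c *m diag_mx mu) c.
  by rewrite -VNV /dotr /u /v !trmx_mul !trmxK !mulmxA.
have cc : 0 < dotr c c by rewrite dotr_gt0.
have lo : mu 0 i * dotr c c <= dotr (c *m diag_mx mu) c.
  rewrite dotr_diag dotrE mulr_sumr; apply: ler_sum => j _; rewrite -expr2.
  case: (ltnP i j) => [ij|ji]; first by rewrite c_small // expr0n !mulr0.
  by rewrite ler_wpM2r ?sqr_ge0 // mudec.
have hi : dotr (u *m diag_mx a) u <= a 0 (inord i) * dotr u u.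
  rewrite dotr_diag dotrE mulr_sumr; apply: ler_sum => j _; rewrite -expr2.
  case: (ltnP j i) => [ji|ij]; first by rewrite u_small // expr0n !mulr0.
  by rewrite ler_wpM2r ?sqr_ge0 // adec // inordK //; have := ltn_ord i; lia.
by rewrite -(ler_pM2r cc) (le_trans lo) // -N1 -uu.
Qed.

(** Rotating the rows of [W] diagonalizes the compression; its ordered eigenvalues are then
    dominated one by one by those of the full matrix, and being positive they can be multiplied. *)
Lemma det_compression_orth n k (W : 'M[R]_(k, n.+1)) (O : 'M[R]_n.+1)
    (a : 'rV[R]_n.+1) : orthomx O -> (forall i, 0 < a 0 i) ->
  (forall i j : 'I_n.+1, (i <= j)%N -> a 0 j <= a 0 i) -> (k <= n.+1)%N ->
  W *m W^T = 1%:M ->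
  \det (W *m (O^T *m diag_mx a *m O) *m W^T) <= \prod_(i < k) a 0 (inord i).
Proof.
move=> OO ap adec kn WW; set N := O^T *m _ *m O; set M := W *m N *m W^T.
have Np : posdefmx N by apply/posdef_diag.
have NT : N^T = N by case: Np.
have [ Q [mu [QQ MQ mudec]]] : exists (Q : 'M[R]_k) mu, [/\ Q *m Q^T = 1%:M,
    M = Q^T *m diag_mx mu *m Q & forall i j : 'I_k, (i <= j)%N -> mu 0 j <= mu 0 i].
  by apply: spectral; rewrite trmx_mul (trmx_mul W) trmxK NT mulmxA.
have detM : \det M = \prod_i mu 0 i.
  by rewrite MQ !det_mulmx det_diag mulrAC -det_mulmx orthomxC // det1 mul1r.
have VV : (Q *m W) *m (Q *m W)^T = 1%:M.
  by rewrite trmx_mul mulmxA -(mulmxA Q) WW mulmx1.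
have VNV : (Q *m W) *m N *m (Q *m W)^T = diag_mx mu.
  rewrite trmx_mul; transitivity (Q *m M *m Q^T); first by rewrite /M !mulmxA.
  by rewrite MQ !mulmxA QQ mul1mx -mulmxA QQ mulmx1.
have mule := compression_eigenvalue_le OO VV VNV adec mudec kn.
have mup i : 0 < mu 0 i.
  rewrite -diag_mxE -VNV -dotr_row row_mul.
  have [_] := (posdefmxP N).1 Np; apply.
  apply: contraTneq (oner_neq0 R) => r0; rewrite negbK; apply/eqP.
  have <- : ((Q *m W) *m (Q *m W)^T) i i = 1 by rewrite VV mxE eqxx.
  by rewrite -dotr_row r0 /dotr mul0mx mxE.
by rewrite detM; apply: ler_prod => i _; rewrite mule ltW.
Qed.

(** Reduction to orthonormal rows: with [B] the square root of the Gram matrix of [W], the rows of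
    [invmx B *m W] are orthonormal, and passing back to [W] multiplies the determinant by that of
    [B *m B]. *)
Lemma det_compression_le n k (W : 'M[R]_(k, n.+1)) (O : 'M[R]_n.+1)
    (a : 'rV[R]_n.+1) : orthomx O -> (forall i, 0 < a 0 i) ->
  (forall i j : 'I_n.+1, (i <= j)%N -> a 0 j <= a 0 i) -> (k <= n.+1)%N ->
  posdefmx (W *m W^T) ->
  \det (W *m (O^T *m diag_mx a *m O) *m W^T) <=
  \det (W *m W^T) * \prod_(i < k) a 0 (inord i).
Proof.
move=> OO ap adec kn Pp; set N := O^T *m _ *m O.
have [Bp BB] := sqrtmxP Pp; set B := sqrtmx _ in Bp BB.
have Bu := posdef_unit Bp; have [BT _] := Bp.
pose W' := invmx B *m W.
have WW' : W = B *m W' by rewrite /W' mulmxA mulmxV // mul1mx.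
have W'1 : W' *m W'^T = 1%:M.
  rewrite /W' trmx_mul trmx_inv BT mulmxA -(mulmxA _ W) -BB mulmxA mulVmx //.
  by rewrite mul1mx mulmxV.
rewrite -BB {1 2}WW' trmx_mul BT.
have -> : B *m W' *m N *m (W'^T *m B) = B *m (W' *m N *m W'^T) *m B.
  by rewrite !mulmxA.
rewrite !det_mulmx mulrAC -expr2 ler_wpM2l ?sqr_ge0 //.
exact: det_compression_orth.
Qed.

(** The product of the [k] largest eigenvalues of [g *m B *m g^T] is the determinant of its
    compression to their eigenvectors [V], which is also the compression of [B] along the rows of
    [V *m g]. The determinant bound is applied to [B], and then to [g *m g^T], in which the Gram
    determinant of [V *m g] is again a compression. *)
Lemma eigenvalue_prod_le n (g B : 'M[R]_n.+1) (O1 O2 O3 : 'M[R]_n.+1)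
    (a b c : 'rV[R]_n.+1) : g \in unitmx ->
  orthomx O1 -> orthomx O2 -> orthomx O3 ->
  (forall i, 0 < a 0 i) -> (forall i, 0 < b 0 i) ->
  (forall i j : 'I_n.+1, (i <= j)%N -> a 0 j <= a 0 i) ->
  (forall i j : 'I_n.+1, (i <= j)%N -> b 0 j <= b 0 i) ->
  g *m g^T = O1^T *m diag_mx a *m O1 -> B = O2^T *m diag_mx b *m O2 ->
  g *m B *m g^T = O3^T *m diag_mx c *m O3 ->
  forall k, (k <= n.+1)%N ->
  \prod_(i < k) c 0 (inord i) <= \prod_(i < k) (a 0 (inord i) * b 0 (inord i)).
Proof.
move=> gu OO1 OO2 OO3 ap bp adec bdec ga Bb gc k kn.
pose V : 'M[R]_(k, n.+1) := rowsub (fun i : 'I_k => inord i) O3.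
have inj (i j : 'I_k) : (inord i : 'I_n.+1) == inord j = (i == j).
  rewrite -!val_eqE /= !inordK //; first by have := ltn_ord j; lia.
  by have := ltn_ord i; lia.
have VM (M : 'M[R]_n.+1) : V *m M *m V^T =
    \matrix_(i, j) (O3 *m M *m O3^T) (inord i) (inord j).
  apply/matrixP => i j.
  by rewrite -dotr_row row_mul !row_rowsub -row_mul dotr_row mxE.
have VV : V *m V^T = 1%:M.
  rewrite -[V in V *m _]mulmx1 VM mulmx1 OO3; apply/matrixP => i j.
  by rewrite !mxE inj.
have detV : \det (V *m g *m B *m (V *m g)^T) = \prod_(i < k) c 0 (inord i).
  have -> : V *m g *m B *m (V *m g)^T = V *m (g *m B *m g^T) *m V^T.
    by rewrite trmx_mul !mulmxA.
  rewrite gc VM !mulmxA OO3 mul1mx -mulmxA OO3 mulmx1.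
  have -> : (\matrix_(i < k, j < k) diag_mx c (inord i) (inord j)) =
      diag_mx (\row_(i < k) c 0 (inord i)).
    by apply/matrixP => i j; rewrite !mxE inj.
  by rewrite det_diag; apply: eq_bigr => i _; rewrite mxE.
have VgVg : V *m g *m (V *m g)^T = V *m (g *m g^T) *m V^T.
  by rewrite trmx_mul !mulmxA.
have VgP : posdefmx (V *m g *m (V *m g)^T).
  apply/posdefmxP; split=> [|v v0]; first by rewrite trmx_mul trmxK.
  rewrite mulmxA dotrM trmxK dotr_gt0; apply: contraNneq v0 => v0.
  have : v *m V = 0 by rewrite -[v *m V](mulmxK gu) -(mulmxA v) v0 mul0mx.
  by move/(congr1 (mulmx^~ V^T)); rewrite mul0mx -mulmxA VV mulmx1 => ->.
rewrite -detV Bb (le_trans (det_compression_le OO2 bp bdec kn VgP)) //.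
rewrite big_split /= ler_wpM2r //.
  by apply: prodr_ge0 => i _; exact: ltW.
by rewrite VgVg ga det_compression_orth.
Qed.

Lemma ln_prod_pos (I : Type) (r : seq I) (F : I -> R) : (forall i, 0 < F i) ->
  ln (\prod_(i <- r) F i) = \sum_(i <- r) ln (F i).
Proof.
move=> F0; elim: r => [|i r IH]; first by rewrite !big_nil ln1.
by rewrite !big_cons lnM ?posrE ?prodr_gt0 // IH.
Qed.

(** Summation by parts with decreasing weights [y] of arbitrary sign; the boundary term [y m] is
    harmless because [w] has total 0. *)
Lemma abel_sum_ge0 m (y w : nat -> R) :
  (forall i, (i < m)%N -> y i.+1 <= y i) ->
  (forall k, (k <= m.+1)%N -> 0 <= \sum_(i < k) w i) ->
  \sum_(i < m.+1) w i = 0 -> 0 <= \sum_(i < m.+1) y i * w i.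
Proof.
move=> ydec wge0 w0.
suff : y m * \sum_(i < m.+1) w i <= \sum_(i < m.+1) y i * w i.
  by rewrite w0 mulr0.
elim: m ydec wge0 {w0} => [|m IHm] ydec wge0.
  by rewrite !big_ord_recl !big_ord0 !addr0.
rewrite big_ord_recr [leRHS]big_ord_recr /= mulrDr lerD2r.
apply: le_trans (IHm _ _); first by rewrite ler_wpM2r ?ydec ?wge0.
- by move=> i im; apply: ydec; exact: ltnW.
- by move=> k km; apply: wge0; exact: leqW.
Qed.

Lemma dotr_CauchySchwarz n (u v : 'rV[R]_n) :
  dotr u v <= Num.sqrt (dotr u u) * Num.sqrt (dotr v v).
Proof.
rewrite -sqrtrM ?dotr_ge0 //; apply: le_trans (ler_norm _) _.
rewrite -sqrtr_sqr ler_wsqrtr //.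
have [->|v0] := eqVneq v 0.
  by rewrite {1}/dotr trmx0 mulmx0 mxE expr0n mulr_ge0 ?dotr_ge0.
have vv : 0 < dotr v v by rewrite dotr_gt0.
have := dotr_ge0 (dotr v v *: u - dotr u v *: v).
rewrite dotrBl !dotrBr !dotrZl !dotrZr (dotrC v u).
rewrite (_ : _ - _ = dotr v v * (dotr u u * dotr v v - dotr u v ^+ 2)); last by ring.
by rewrite pmulr_rge0 // subr_ge0.
Qed.

Lemma dR1_diag_dotr n (O : 'M[R]_n) (d : 'rV[R]_n) : orthomx O ->
  let x := \row_i ln (d 0 i) in
  dR 1%:M (O^T *m diag_mx d *m O) = Num.sqrt (dotr x x).
Proof.
move=> OO x; rewrite dR1_diag // dotrE; congr Num.sqrt.
by apply: eq_bigr => i _; rewrite mxE expr2.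
Qed.

(** Let x, y, z be the decreasing vectors of logarithms of the eigenvalues of [g *m B *m g^T],
    [g *m g^T] and [B]. By log-majorization y + z - x has nonnegative partial sums, and its total is
    0 by multiplicativity of the determinant. Since x is decreasing, Abel summation gives <x, x> <=
    <x, y + z>, and Cauchy-Schwarz turns this into |x| <= |y| + |z|. *)
Lemma dR1_congr n (g B : 'M[R]_n) : g \in unitmx -> posdefmx B ->
  dR 1%:M (g *m B *m g^T) <= dR 1%:M (g *m g^T) + dR 1%:M B.
Proof.
case: n g B => [g B _ _|n g B gu Bp].
  by rewrite (_ : g *m B *m g^T = B) ?lerDr ?dR1_ge0 //; apply/matrixP => -[].
have [ O1 [a [OO1 ga ap adec]]] := posdef_spectral (posdef_gram gu).
have [ O2 [b [OO2 Bb bp bdec]]] := posdef_spectral Bp.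
have [ O3 [c [OO3 gc cp cdec]]] := posdef_spectral (posdef_congr Bp gu).
have le := eigenvalue_prod_le gu OO1 OO2 OO3 ap bp adec bdec ga Bb gc.
have eqdet : \prod_i c 0 i = \prod_i (a 0 i * b 0 i).
  have detD (O : 'M[R]_n.+1) (d : 'rV_n.+1) : orthomx O ->
      \det (O^T *m diag_mx d *m O) = \prod_i d 0 i.
    move=> OO; rewrite !det_mulmx det_diag mulrAC -det_mulmx orthomxC //.
    by rewrite det1 mul1r.
  rewrite big_split /= -(detD O1 a) // -(detD O2 b) // -(detD O3 c) // -ga -Bb -gc.
  by rewrite !det_mulmx mulrAC.
rewrite ga gc Bb !dR1_diag_dotr //.
set x := \row_i ln (c 0 i); set y := \row_i ln (a 0 i); set z := \row_i ln (b 0 i).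
suff xx : dotr x x <= dotr x (y + z).
  have [->|x0] := eqVneq (dotr x x) 0; first by rewrite sqrtr0 addr_ge0 ?sqrtr_ge0.
  have sx : 0 < Num.sqrt (dotr x x) by rewrite sqrtr_gt0 lt0r x0 dotr_ge0.
  rewrite -(ler_pM2l sx) -expr2 sqr_sqrtr ?dotr_ge0 // mulrDr (le_trans xx) //.
  by rewrite dotrDr lerD // dotr_CauchySchwarz.
pose Y i := ln (c 0 (inord i)).
pose w i := ln (a 0 (inord i)) + ln (b 0 (inord i)) - ln (c 0 (inord i)).
have sumw k : \sum_(i < k) w i = ln (\prod_(i < k) (a 0 (inord i) * b 0 (inord i)))
    - ln (\prod_(i < k) c 0 (inord i)).
  have abp i : 0 < a 0 i * b 0 i by rewrite mulr_gt0.
  rewrite (ln_prod_pos _ (fun i : 'I_k => abp (inord i))).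
  rewrite (ln_prod_pos _ (fun i : 'I_k => cp (inord i))).
  by rewrite -sumrB; apply: eq_bigr => i _; rewrite /w lnM ?posrE.
rewrite -subr_ge0 -dotrBr.
have -> : dotr x (y + z - x) = \sum_(i < n.+1) Y i * w i.
  by rewrite dotrE; apply: eq_bigr => i _; rewrite !mxE /Y /w inord_val.
apply: abel_sum_ge0.
- move=> i im; rewrite /Y ler_ln ?posrE // cdec //.
  by rewrite !inordK //; lia.
- move=> k kn; rewrite sumw subr_ge0 ler_ln ?posrE ?prodr_gt0 ?le //.
  by move=> i _; rewrite mulr_gt0.
- rewrite sumw; under eq_bigr do rewrite inord_val.
  under [in X in _ - X]eq_bigr do rewrite inord_val.
  by rewrite eqdet subrr.
Qed.

Lemma invmx_uniq n (A B : 'M[R]_n) : A *m B = 1%:M -> invmx A = B.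
Proof.
move=> AB; rewrite -[B]mul1mx -(mulVmx (mulmx1_unit AB).1).
by rewrite -mulmxA AB mulmx1.
Qed.

Lemma dR1_inv n (A : 'M[R]_n) : posdefmx A -> dR 1%:M (invmx A) = dR 1%:M A.
Proof.
move=> /posdef_spectral [ O [d [OO -> dp _]]].
have -> : invmx (O^T *m diag_mx d *m O) =
    O^T *m diag_mx (\row_i (d 0 i)^-1) *m O.
  apply: invmx_uniq.
  rewrite orth_diagM // -[RHS](orthomxC OO) -[X in _ = X *m O]mulmx1.
  congr (_ *m _ *m _); rewrite -diag_const_mx; congr diag_mx.
  by apply/rowP => i; rewrite !mxE mulfV // gt_eqF.
rewrite !dR1_diag //; congr Num.sqrt; apply: eq_bigr => i _.
by rewrite mxE lnV ?posrE // sqrrN.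
Qed.

Lemma dR1_gramC n (g : 'M[R]_n) : g \in unitmx ->
  dR 1%:M (g^T *m g) = dR 1%:M (g *m g^T).
Proof.
move=> gu; apply: dR1_char_poly.
by rewrite -(char_poly_conj (g^T *m g) gu) !mulmxA mulmxK.
Qed.

Definition mxlen n (g : 'M[R]_n) := dR 1%:M (g *m g^T).

Lemma mxlen_ge0 n (g : 'M[R]_n) : 0 <= mxlen g.
Proof. exact: dR1_ge0. Qed.

Lemma mxlen1 n : mxlen (1%:M : 'M[R]_n) = 0.
Proof.
rewrite /mxlen trmx1 mulmx1.
have E : 1%:M = 1%:M^T *m diag_mx (const_mx 1) *m 1%:M :> 'M[R]_n.
  by rewrite diag_const_mx trmx1 !mulmx1.
rewrite [X in dR _ X]E dR1_diag; last by rewrite /orthomx trmx1 mulmx1.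
by rewrite big1 ?sqrtr0 // => i _; rewrite mxE ln1 expr0n.
Qed.

Lemma mxlenM n (g h : 'M[R]_n) : g \in unitmx -> h \in unitmx ->
  mxlen (g *m h) <= mxlen g + mxlen h.
Proof.
move=> gu hu; rewrite /mxlen.
have -> : g *m h *m (g *m h)^T = g *m (h *m h^T) *m g^T by rewrite trmx_mul !mulmxA.
by apply: dR1_congr => //; apply: posdef_gram.
Qed.

Lemma mxlenV n (g : 'M[R]_n) : g \in unitmx -> mxlen (invmx g) = mxlen g.
Proof.
move=> gu; rewrite /mxlen.
have -> : invmx g *m (invmx g)^T = invmx (g^T *m g).
  apply/esym/invmx_uniq.
  by rewrite mulmxA -(mulmxA _ g) mulmxV // mulmx1 trmx_inv mulmxV // unitmx_tr.
rewrite dR1_inv ?dR1_gramC //.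
by have := @posdef_gram _ n g^T; rewrite trmxK unitmx_tr; apply.
Qed.
End Triangle.

(** * Measurability of matrix functions *)

Section EntrywiseMeasurable.
Context {R : realType} {d : measure_display} {T : measurableType d}.

Definition mxmeas n p (F : T -> 'M[R]_(n, p)) :=
  forall i j, measurable_fun [set: T] (fun w => F w i j).

Lemma mxmeas_cst n p (A : 'M[R]_(n, p)) : mxmeas (fun=> A).
Proof. by move=> i j; exact: measurable_cst. Qed.

Lemma mxmeas_ext n p (F G : T -> 'M[R]_(n, p)) : F =1 G -> mxmeas F -> mxmeas G.
Proof. by move=> /funext ->. Qed.

Lemma mxmeasD n p (F G : T -> 'M[R]_(n, p)) : mxmeas F -> mxmeas G ->
  mxmeas (fun w => F w + G w).
Proof.
move=> mF mG i j; under eq_fun do rewrite mxE.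
exact: measurable_funD.
Qed.

Lemma mxmeasB n p (F G : T -> 'M[R]_(n, p)) : mxmeas F -> mxmeas G ->
  mxmeas (fun w => F w - G w).
Proof.
move=> mF mG i j; under eq_fun do rewrite !mxE.
exact: measurable_funB.
Qed.

Lemma mxmeasZ n p (f : T -> R) (F : T -> 'M[R]_(n, p)) :
  measurable_fun [set: T] f -> mxmeas F -> mxmeas (fun w => f w *: F w).
Proof.
move=> mf mF i j; under eq_fun do rewrite mxE.
exact: measurable_funM.
Qed.

Lemma mxmeasT n p (F : T -> 'M[R]_(n, p)) : mxmeas F -> mxmeas (fun w => (F w)^T).
Proof. by move=> mF i j; under eq_fun do rewrite mxE; exact: mF. Qed.

Lemma mxmeasM n p q (F : T -> 'M[R]_(n, p)) (G : T -> 'M[R]_(p, q)) :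
  mxmeas F -> mxmeas G -> mxmeas (fun w => F w *m G w).
Proof.
move=> mF mG i j; under eq_fun do rewrite mxE.
by apply: measurable_sum => k; exact: measurable_funM.
Qed.

Lemma measurable_mxtrace n (F : T -> 'M[R]_n) : mxmeas F ->
  measurable_fun [set: T] (fun w => \tr (F w)).
Proof. by move=> mF; apply: measurable_sum => i; exact: mF. Qed.

Lemma measurable_det n (F : T -> 'M[R]_n) : mxmeas F ->
  measurable_fun [set: T] (fun w => \det (F w)).
Proof.
move=> mF; apply: measurable_sum => s; apply: measurable_funM => //.
by apply: measurable_prod => i _; exact: mF.
Qed.

Lemma measurable_inv (f : T -> R) : measurable_fun [set: T] f ->
  measurable_fun [set: T] (fun w => (f w)^-1).
Proof.
move=> mf; rewrite (_ : (fun _ => _) = (fun w => f w * (f w ^+ 2) `^ (-1))).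
  apply: measurable_funM => //.
  apply: (@measurableT_comp _ _ _ _ _ _ (fun x : R => x `^ (-1)) _
    (fun w => f w ^+ 2)); first exact: measurable_powR.
  exact: measurable_funX.
apply/funext => w; rewrite powR_inv1 ?sqr_ge0 //.
by have [->|f0] := eqVneq (f w) 0; [rewrite invr0 mul0r|field].
Qed.

Lemma mxmeasV n (F : T -> 'M[R]_n) : (forall w, F w \in unitmx) ->
  mxmeas F -> mxmeas (fun w => invmx (F w)).
Proof.
move=> Fu mF i j.
rewrite (_ : (fun _ => _) = fun w => (\det (F w))^-1 * cofactor (F w) j i).
  apply: measurable_funM; first exact/measurable_inv/measurable_det.
  apply: measurable_funM => //; apply: measurable_det => a b.
  by under eq_fun do rewrite !mxE; exact: mF.
by apply/funext => w; rewrite /invmx Fu !mxE.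
Qed.

Lemma measurable_sqrtr (f : T -> R) : measurable_fun [set: T] f ->
  measurable_fun [set: T] (fun w => Num.sqrt (f w)).
Proof.
move=> mf; apply: measurableT_comp mf; apply: continuous_measurable_fun.
exact: sqrt_continuous.
Qed.

End EntrywiseMeasurable.

(** * Measurability of the square root and of the distance to the identity *)

Section SqrtMeasurable.
Variable R : realType.

(* With [c >= sqrt a] the iteration [b |-> b + (a - b^2) / (2 c)] increases
   from [0] to [sqrt a]; on matrices it is a polynomial in [A]. *)
Fixpoint sqrt_iter n (c : R) (A : 'M[R]_n) k : 'M[R]_n :=
  if k is j.+1 then
    let B := sqrt_iter c A j in B + (2 * c)^-1 *: (A - B *m B)
  else 0.

Fixpoint sqrt_iterr (c a : R) k : R :=
  if k is j.+1 then
    let b := sqrt_iterr c a j in b + (2 * c)^-1 * (a - b ^+ 2)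
  else 0.

Lemma sqrt_iter_diag n (O : 'M[R]_n) (d : 'rV[R]_n) c k : orthomx O ->
  sqrt_iter c (O^T *m diag_mx d *m O) k =
  O^T *m diag_mx (\row_i sqrt_iterr c (d 0 i) k) *m O.
Proof.
move=> OO; elim: k => [|k IHk] /=.
  rewrite (_ : \row_i _ = 0); last by apply/rowP => i; rewrite !mxE.
  by rewrite linear0 mulmx0 mul0mx.
rewrite IHk orth_diagM // -mulmxBl -mulmxBr scalemxAl scalemxAr.
rewrite -mulmxDl -mulmxDr; congr (_ *m _ *m _).
rewrite -linearB -linearZ -linearD /=; congr diag_mx.
by apply/rowP => i; rewrite !mxE expr2.
Qed.

(** One iteration multiplies the error [b - s] by [1 - b / (2 * c) - s / (2 * c)], which lies
    between 0 and [1 - b / (2 * c)] as long as [0 <= s <= b <= c]. *)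
Lemma sqrt_iterr_bound (c b : R) k : 0 < b -> b <= c ->
  [/\ 0 <= sqrt_iterr c (b ^+ 2) k, sqrt_iterr c (b ^+ 2) k <= b &
    b - sqrt_iterr c (b ^+ 2) k <= b * (1 - b / (2 * c)) ^+ k].
Proof.
move=> b0 bc; have c0 : 0 < c by exact: lt_le_trans bc.
pose q := b / (2 * c); have c2 : 0 < (2 * c)^-1 by rewrite invr_gt0 mulr_gt0.
have q0 : 0 <= q by rewrite mulr_ge0 // ltW.
have q1 : q <= 2^-1 by rewrite ler_pdivrMr ?mulr_gt0 // mulKf.
elim: k => [|k [s0 sb IH]] /=; first by rewrite subr0 expr0 mulr1; split => //; rewrite ltW.
set s := sqrt_iterr _ _ _ in s0 sb IH *.
have r0 : 0 <= s / (2 * c) by rewrite mulr_ge0 // ltW.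
have rq : s / (2 * c) <= q by rewrite ler_pM2r.
have E : b - (s + (2 * c)^-1 * (b ^+ 2 - s ^+ 2)) =
    (b - s) * (1 - q - s / (2 * c)).
  by rewrite /q; field; rewrite gt_eqF.
have bs : 0 <= b - s by rewrite subr_ge0.
split.
- by rewrite addr_ge0 // mulr_ge0 ?(ltW c2) //; nra.
- by rewrite -subr_ge0 E mulr_ge0 //; lra.
- rewrite E exprSr mulrA; apply: (@le_trans _ _ ((b - s) * (1 - q))).
    by rewrite ler_wpM2l //; lra.
  by rewrite ler_wpM2r //; lra.
Qed.

Lemma sqrt_iterr_cvg (c b : R) : 0 < b -> b <= c ->
  sqrt_iterr c (b ^+ 2) k @[k --> \oo] --> b.
Proof.
move=> b0 bc; have c0 : 0 < c by exact: lt_le_trans bc.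
have q0 : 0 < b / (2 * c) by rewrite divr_gt0 // mulr_gt0.
have q1 : b / (2 * c) <= 2^-1 by rewrite ler_pdivrMr ?mulr_gt0 // mulKf.
apply: (@squeeze_cvgr _ _ _ _ (fun k => b - b * (1 - b / (2 * c)) ^+ k) (cst b)).
- apply: nearW => k; have [_ h1 h2] := sqrt_iterr_bound k b0 bc.
  by rewrite h1 andbT; lra.
- rewrite -[X in _ --> X](subr0 b); apply: cvgB; first exact: cvg_cst.
  rewrite -[X in _ --> X](mulr0 b); apply: cvgM; first exact: cvg_cst.
  by apply: cvg_expr; rewrite ger0_norm; lra.
- exact: cvg_cst.
Qed.

Lemma trace_diag_orth n (O : 'M[R]_n) (d : 'rV[R]_n) : orthomx O ->
  \tr (O^T *m diag_mx d *m O) = \sum_i d 0 i.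
Proof. by move=> OO; rewrite mxtrace_mulC mulmxA OO mul1mx mxtrace_diag. Qed.

Lemma cvg_mx_entry_diag n (O : 'M[R]_n) (b : nat -> 'rV[R]_n) (d : 'rV[R]_n) i j :
  (forall l, b k 0 l @[k --> \oo] --> d 0 l) ->
  (O^T *m diag_mx (b k) *m O) i j @[k --> \oo] --> (O^T *m diag_mx d *m O) i j.
Proof.
move=> bd.
have E e : (O^T *m diag_mx e *m O) i j = \sum_l O^T i l * e 0 l * O l j.
  by rewrite mxE; apply: eq_bigr => l _; rewrite mul_mx_diag mxE.
rewrite E; under eq_cvg do rewrite E.
apply: (@cvg_big _ _ +%R 0) => [|l _]; first exact: add_continuous.
apply: cvgM; last exact: cvg_cst.
by apply: cvgM; [exact: cvg_cst|exact: bd].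
Qed.

(** A basis diagonalizing the chosen root also diagonalizes [A], so the iteration splits into scalar
    ones. The constant [1 + \tr A] is admissible because every eigenvalue b of the root satisfies b
    <= 1 + b^2 <= 1 + tr A, and it depends measurably on [A]. *)
Lemma sqrtmx_cvg n (A : 'M[R]_n) i j : posdefmx A ->
  sqrt_iter (1 + \tr A) A k i j @[k --> \oo] --> sqrtmx A i j.
Proof.
move=> /sqrtmxP [/posdef_spectral [ O [b [OO Bb bp _]]] BB].
have AE : A = O^T *m diag_mx (\row_l (b 0 l ^+ 2)) *m O.
  have -> : \row_l (b 0 l ^+ 2) = \row_l (b 0 l * b 0 l).
    by apply/rowP => l; rewrite !mxE expr2.
  by rewrite -orth_diagM // -Bb BB.
have trA : \tr A = \sum_l b 0 l ^+ 2.
  by rewrite AE trace_diag_orth //; apply: eq_bigr => l _; rewrite mxE.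
rewrite Bb {2}AE; under eq_cvg do rewrite sqrt_iter_diag //.
apply: cvg_mx_entry_diag => l.
under eq_cvg do rewrite !mxE.
apply: sqrt_iterr_cvg => //; rewrite trA (bigD1 l) //=.
have : 0 <= \sum_(k < n | k != l) b 0 k ^+ 2 by apply: sumr_ge0 => k _; exact: sqr_ge0.
by have := bp l; nra.
Qed.

Lemma mxmeas_sqrtmx d (T : measurableType d) n (F : T -> 'M[R]_n) :
  (forall w, posdefmx (F w)) -> mxmeas F -> mxmeas (fun w => sqrtmx (F w)).
Proof.
move=> Fp mF i j.
apply: (@measurable_fun_cvg _ _ _ _
  (fun k w => sqrt_iter (1 + \tr (F w)) (F w) k i j)) => [k|w _].
  move: i j; elim: k => [|k IHk]; first exact: mxmeas_cst.
  apply: mxmeasD => //; apply: mxmeasZ.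
    apply/measurable_inv/measurable_funM => //.
    by apply: measurable_funD => //; exact: measurable_mxtrace.
  by apply: mxmeasB => //; exact: mxmeasM.
exact: sqrtmx_cvg.
Qed.

Lemma posdef_iter_sqrtmx n (A : 'M[R]_n) k : posdefmx A ->
  posdefmx (iter k (@sqrtmx R n) A).
Proof. by move=> Ap; elim: k => //= k /sqrtmxP []. Qed.

(** Squeezed by 1 + h <= exp h <= 1 / (1 - h) at h = y / 2^k, once this is below 1. *)
Lemma expr_dyadic_cvg (y : R) :
  2 ^+ k * (expR (y / 2 ^+ k) - 1) @[k --> \oo] --> y.
Proof.
have h0 : y / 2 ^+ k @[k --> \oo] --> 0.
  rewrite -[X in _ --> X](mulr0 y); apply: cvgM; first exact: cvg_cst.
  under eq_cvg do rewrite -exprVn.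
  by apply: cvg_expr; rewrite ger0_norm; lra.
apply: (@squeeze_cvgr _ _ _ _ (cst y) (fun k => y / (1 - y / 2 ^+ k))).
- near=> k.
  have : y / 2 ^+ k < 1 by near: k; exact: (cvgr_lt _ h0).
  set h := y / 2 ^+ k => h1.
  have p0 : 0 < 2 ^+ k :> R by rewrite exprn_gt0.
  have yE : y = 2 ^+ k * h by rewrite /h mulrC divfK // gt_eqF.
  apply/andP; split; first by rewrite {1}yE ler_pM2l // lerBrDl expR_ge1Dx.
  rewrite {1}yE -mulrA ler_pM2l //.
  have g : expR h * (1 - h) <= 1.
    by rewrite -[leRHS](expRxMexpNx_1 h) ler_pM2l ?expR_gt0 // expR_ge1Dx.
  by rewrite ler_pdivlMr ?subr_gt0 //; nra.
- exact: cvg_cst.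
- rewrite -[X in _ --> X]divr1; apply: cvgM; first exact: cvg_cst.
  apply: cvgV; first exact: oner_neq0.
  by rewrite -[X in _ --> X](subr0 1); apply: cvgB => //; exact: cvg_cst.
Unshelve. all: by end_near. Qed.

Lemma iter_sqr_diag n (O : 'M[R]_n) (b : 'rV[R]_n) k : orthomx O ->
  iter k (fun M => M *m M) (O^T *m diag_mx b *m O) =
  O^T *m diag_mx (\row_i b 0 i ^+ (2 ^ k)) *m O.
Proof.
move=> OO; elim: k => [|k IHk] /=.
  by congr (_ *m diag_mx _ *m _); apply/rowP => i; rewrite mxE.
rewrite IHk orth_diagM //; congr (_ *m diag_mx _ *m _).
by apply/rowP => i; rewrite !mxE -exprD expnS mul2n addnn.
Qed.

(* The k-fold square root of A has eigenvalues a^(1/2^k), and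
   2^k (a^(1/2^k) - 1) tends to ln a. *)
Lemma dR1_cvg n (A : 'M[R]_n) : posdefmx A ->
  let L k := 2 ^+ k *: (iter k (@sqrtmx R n) A - 1%:M) in
  Num.sqrt (\tr (L k *m L k)) @[k --> \oo] --> dR 1%:M A.
Proof.
move=> Ap L; have [ Q [a [QQ AE ap _]]] := posdef_spectral Ap.
have trL k : \tr (L k *m L k) = \sum_i (2 ^+ k * (expR (ln (a 0 i) / 2 ^+ k) - 1)) ^+ 2.
  have Bp := posdef_iter_sqrtmx k Ap.
  have BA : iter k (fun M => M *m M) (iter k (@sqrtmx R n) A) = A.
    elim: (k) => // j IH; rewrite iterSr /=.
    by have [_ ->] := sqrtmxP (posdef_iter_sqrtmx j Ap).
  rewrite /L; set B := iter k _ A in Bp BA *.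
  have [ O [b [OO BE bp _]]] := posdef_spectral Bp.
  (* The diagonalizations of [A] and of its iterated root [B] come from separate choices; comparing
     characteristic polynomials matches the eigenvalues of [A] with the powers of those of [B], up
     to order. *)
  have perm : perm_eq [seq a 0 i | i : 'I_n] [seq b 0 i ^+ (2 ^ k) | i : 'I_n].
    have E (f : 'I_n -> R) : \prod_(x <- [seq f i | i : 'I_n]) ('X - x%:P) =
        \prod_i ('X - (f i)%:P) by rewrite big_map big_enum.
    apply: prod_XsubC_eq; rewrite !E -(char_poly_diag a QQ) -AE.
    rewrite -BA BE iter_sqr_diag // char_poly_diag //.
    by apply: eq_bigr => i _; rewrite mxE.
  transitivity (\sum_(x <- [seq a 0 i | i : 'I_n])
      (2 ^+ k * (expR (ln x / 2 ^+ k) - 1)) ^+ 2); last first.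
    by rewrite big_map big_enum.
  rewrite (perm_big _ perm) big_map big_enum /=.
  have LE : 2 ^+ k *: (B - 1%:M) =
      O^T *m diag_mx (\row_i (2 ^+ k * (b 0 i - 1))) *m O.
    have -> : 1%:M = O^T *m diag_mx (const_mx 1) *m O.
      by rewrite diag_const_mx mulmx1 orthomxC.
    rewrite BE -mulmxBl -mulmxBr scalemxAl scalemxAr -linearB -linearZ /=.
    by congr (_ *m diag_mx _ *m _); apply/rowP => i; rewrite !mxE.
  rewrite LE orth_diagM // trace_diag_orth //; apply: eq_bigr => i _.
  have -> : ln (b 0 i ^+ (2 ^ k)) / 2 ^+ k = ln (b 0 i).
    rewrite lnXn // -[ln _ *+ _]mulr_natr natrX mulfK //.
  by rewrite !mxE -expr2 lnK ?posrE.
rewrite AE dR1_diag //.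
have h : \tr (L k *m L k) @[k --> \oo] --> \sum_i ln (a 0 i) ^+ 2.
  under eq_cvg do rewrite trL.
  apply: (@cvg_big _ _ +%R 0) => [|l _]; first exact: add_continuous.
  under eq_cvg do rewrite expr2.
  by rewrite expr2; apply: cvgM; exact: expr_dyadic_cvg.
by apply: (cvg_comp _ _ h); exact: sqrt_continuous.
Qed.

Lemma measurable_dR1 d (T : measurableType d) n (F : T -> 'M[R]_n) :
  (forall w, posdefmx (F w)) -> mxmeas F ->
  measurable_fun [set: T] (fun w => dR 1%:M (F w)).
Proof.
move=> Fp mF.
apply: (@measurable_fun_cvg _ _ _ _ (fun k w => Num.sqrt (\tr
   ((2 ^+ k *: (iter k (@sqrtmx R n) (F w) - 1%:M)) *m
    (2 ^+ k *: (iter k (@sqrtmx R n) (F w) - 1%:M)))))) => [k|w _].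
  have mI : mxmeas (fun w => iter k (@sqrtmx R n) (F w)).
    elim: k => //= k IHk; apply: mxmeas_sqrtmx => // w.
    exact: posdef_iter_sqrtmx.
  have mL : mxmeas (fun w => 2 ^+ k *: (iter k (@sqrtmx R n) (F w) - 1%:M)).
    by apply: mxmeasZ => //; apply: mxmeasB => //; exact: mxmeas_cst.
  by apply/measurable_sqrtr/measurable_mxtrace/mxmeasM.
exact: dR1_cvg.
Qed.

End SqrtMeasurable.

(** * Chains of stopping times *)

Section RealProbability.
Context d (T : measurableType d) (R : realType) (P : probability T R).
Implicit Types A B : set T.

Lemma PrE A : measurable A -> P A = (Pr P A)%:E.
Proof. by move=> mA; rewrite /Pr fineK // fin_num_measure. Qed.

Lemma Pr_ge0 A : 0 <= Pr P A.
Proof. exact: fine_ge0. Qed.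

Lemma Pr_le A B : measurable A -> measurable B -> A `<=` B -> Pr P A <= Pr P B.
Proof. by move=> mA mB AB; rewrite -lee_fin -!PrE // le_measure // inE. Qed.

Lemma Pr_setT : Pr P setT = 1.
Proof. by rewrite /Pr probability_setT. Qed.

Lemma Pr_set0 : Pr P set0 = 0.
Proof. by rewrite /Pr measure0. Qed.

Lemma Pr_le1 A : measurable A -> Pr P A <= 1.
Proof. by move=> mA; rewrite -Pr_setT Pr_le. Qed.

Lemma Pr_setU A B : measurable A -> measurable B -> A `&` B = set0 ->
  Pr P (A `|` B) = Pr P A + Pr P B.
Proof.
move=> mA mB AB; apply: EFin_inj; rewrite EFinD -!PrE //; last exact: measurableU.
by rewrite measureU.
Qed.

Lemma Pr_setU_le A B : measurable A -> measurable B ->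
  Pr P (A `|` B) <= Pr P A + Pr P B.
Proof.
move=> mA mB; rewrite -lee_fin EFinD -!PrE //; last exact: measurableU.
exact: measureU2.
Qed.

Lemma Pr_setC A : measurable A -> Pr P (~` A) = 1 - Pr P A.
Proof.
move=> mA; rewrite -Pr_setT -(setvU A) Pr_setU ?addrK //; last exact: setICl.
exact: measurableC.
Qed.

Lemma Pr_exists_le (A : nat -> set T) k n : (k <= n)%N ->
  (forall j, (k < j <= n)%N -> measurable (A j)) ->
  measurable [set w | exists2 j, (k < j <= n)%N & A j w] /\
  Pr P [set w | exists2 j, (k < j <= n)%N & A j w] <=
  \sum_(k.+1 <= j < n.+1) Pr P (A j).
Proof.
elim: n => [|n IHn] kn mA.
  rewrite (_ : mkset _ = set0); first by rewrite big_geq ?Pr_set0 //; lia.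
  by apply/seteqP; split => [w [j]|//]; lia.
have [->|kn'] := eqVneq k n.+1.
  rewrite (_ : mkset _ = set0); first by rewrite big_geq ?Pr_set0.
  by apply/seteqP; split => [w [j]|//]; lia.
have [|j jk|mI IH] := IHn; [lia|apply: mA; lia|].
have mAn : measurable (A n.+1) by apply: mA; lia.
rewrite (_ : mkset _ = [set w | exists2 j, (k < j <= n)%N & A j w] `|` A n.+1).
  split; first exact: measurableU.
  rewrite big_nat_recr /=; last by lia.
  by rewrite (le_trans (Pr_setU_le _ _)) // lerD2r.
apply/seteqP; split => [w [j jk Aj]|w [[j jk Aj]|Aw]] /=.
- have [<-|jn] := eqVneq j n.+1; [by right|left].
  by exists j => //; lia.
- by exists j => //; lia.
- by exists n.+1 => //; lia.
Qed.

End RealProbability.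

Lemma measurable_gt_fun d (T : measurableType d) (R : realType) (f : T -> R) a :
  measurable_fun setT f -> measurable [set w | a < f w].
Proof.
move=> mf; rewrite (_ : [set w | _] = setT `&` f @^-1` `]a, +oo[%classic).
  by apply: mf => //; exact: measurable_itv.
by rewrite setTI; apply/seteqP; split => w /=; rewrite in_itv /= andbT.
Qed.

(** * Stopping times along a path, and the deterministic bound *)

Section HitTimes.
Context (T : Type) (R : realType) (D : nat -> nat -> T -> R) (n : nat).

Definition hit k K a := [set w | exists2 j, (k < j <= K)%N & a < D k j w].

Definition hit_first k a j := [set w | a < D k j w] `&` ~` hit k j.-1 a.

(* The chain of stopping times started at k, the next one being the first
   time at which the walk is more than a away from its current position,
   for a running through s, is completed by time n. *)
Fixpoint completes k (s : seq R) : set T :=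
  if s is a :: s' then
    [set w | exists2 j, (k < j <= n)%N & (hit_first k a j `&` completes j s') w]
  else setT.

Lemma hitS k K a : (k <= K)%N -> hit k K.+1 a = hit k K a `|` hit_first k a K.+1.
Proof.
move=> kK; apply/seteqP; split => [w [j jk Dj]|w [[j jk Dj]|[Dw _]]].
- have [h|h] := pselect (hit k K a w); [by left|right].
  split => //; have [<-//|jK] := eqVneq j K.+1.
  by case: h; exists j => //; lia.
- by exists j => //; lia.
- by exists K.+1 => //; lia.
Qed.

Lemma hit_ex_first k K a w : hit k K a w ->
  exists2 j, (k < j <= K)%N & hit_first k a j w.
Proof.
move=> [j jk Dj].
have ex : exists j, [&& (k < j)%N, (j <= K)%N & a < D k j w].
  by exists j; case/andP: jk => -> ->.
case: (ex_minnP ex) => i /and3P[ki iK Di] imin; exists i; first by rewrite ki.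
split => // -[q qi Dq]; have := imin q; rewrite Dq; lia.
Qed.

Hypothesis D_ge0 : forall i j w, 0 <= D i j w.
Hypothesis Dii : forall i w, D i i w = 0.
Hypothesis D_triangle : forall i j k w, D i k w <= D i j w + D j k w.

(* Up to the first time not reached, each stopping time contributes its
   threshold and the last jump before it. *)
Lemma not_completes_bound k s w : (k <= n)%N -> all (fun a => 0 <= a) s ->
  ~ completes k s w ->
  exists I : seq nat, [/\ uniq I, all (fun i => k <= i < n)%N I,
    (size I <= (size s).-1)%N & forall j, (k <= j <= n)%N ->
    D k j w <= \sum_(a <- s) a + \sum_(i <- I) D i i.+1 w].
Proof.
elim: s k => [|a s IHs] k kn; first by move=> _ /(_ Logic.I).
move=> /= /andP[a0 s0] nc.
have ss : 0 <= \sum_(b <- s) b.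
  by rewrite big_seq; apply: sumr_ge0 => b /(allP s0).
have [|nhit] := pselect (hit k n a w); last first.
  exists [::]; split => // j /andP[kj jn].
  rewrite big_nil addr0 big_cons; apply: ler_wpDr => //.
  have [<-|kj'] := eqVneq k j; first by rewrite Dii.
  rewrite leNgt; apply/negP => aD; apply: nhit; exists j => //.
  by rewrite jn andbT ltn_neqAle kj' kj.
move=> /hit_ex_first [j /andP[kj jn] [/= aD nfirst]].
have {}nc : ~ completes j s w.
  by move=> cj; apply: nc; exists j; rewrite ?kj.
have [I [uI Ikn sI DI]] := IHs j jn s0 nc.
(* The empty chain is always completed, so a failing chain has a threshold left after [j]. This
   keeps the number of charged jumps below the number of thresholds. *)
have s_gt0 : (0 < size s)%N by case: (s) nc => // /(_ Logic.I).
have DI0 : 0 <= \sum_(i <- I) D i i.+1 w by apply: sumr_ge0.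
have before i : (k <= i < j)%N -> D k i w <= a.
  move=> /andP[ki ij]; have [<-|ki'] := eqVneq k i; first by rewrite Dii.
  rewrite leNgt; apply/negP => aDi; apply: nfirst; exists i => //; lia.
(* The jump into position [j] has index [j.-1], while all indices in [I] are at least [j]; hence the
   jumps stay distinct. *)
exists (j.-1 :: I); split => [||/=|i /andP[ki iN]].
- rewrite cons_uniq uI andbT; apply/negP => /(allP Ikn) /andP[]; lia.
- rewrite /= (_ : (k <= j.-1 < n)%N); last by lia.
  by apply/allP => i /(allP Ikn) /andP[]; lia.
- by rewrite (leq_ltn_trans sI) // ltn_predL.
rewrite !big_cons prednK; last by lia.
case: (ltnP i j) => ij.
  have := before i; rewrite ki ij => /(_ isT); have := D_ge0 j.-1 j w; lra.
have := DI i; rewrite ij iN => /(_ isT).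
have := D_triangle k j i w; have := D_triangle k j.-1 j w.
by have := before j.-1; rewrite (_ : (k <= j.-1 < j)%N) => [/(_ isT)|]; [lra|lia].
Qed.

End HitTimes.

Section HitMeasurable.
Context d (T : measurableType d) (R : realType) (D : nat -> nat -> T -> R).

Lemma measurable_hit k K a :
  (forall j, (k < j <= K)%N -> measurable_fun setT (D k j)) ->
  measurable (hit D k K a).
Proof.
move=> mD.
rewrite (_ : hit D k K a =
    \bigcup_(j in [set j | (k < j <= K)%N]) [set w | a < D k j w]).
  by apply: bigcup_measurable => j /= jk; apply: measurable_gt_fun; exact: mD.
by apply/seteqP; split => w [j jk Dj]; exists j.
Qed.

Lemma measurable_hit_first k a j : (k < j)%N ->
  (forall i, (k < i <= j)%N -> measurable_fun setT (D k i)) ->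
  measurable (hit_first D k a j).
Proof.
move=> kj mD; apply: measurableI.
  by apply: measurable_gt_fun; apply: mD; rewrite kj /=.
by apply/measurableC/measurable_hit => i ki; apply: mD; lia.
Qed.

Lemma measurable_completes n k s :
  (forall i j, (k <= i <= j)%N -> measurable_fun setT (D i j)) ->
  measurable (completes D n k s).
Proof.
move=> mD; suff : forall i, (k <= i)%N -> measurable (completes D n i s) by exact.
elim: s => [|a s IHs] i ki /=; first exact: measurableT.
rewrite (_ : mkset _ = \bigcup_(j in [set j | (i < j <= n)%N])
    (hit_first D i a j `&` completes D n j s)).
  apply: bigcup_measurable => j /= /andP[ij jn]; apply: measurableI.
    by apply: measurable_hit_first => // q qi; apply: mD; lia.
  by apply: IHs; lia.
by apply/seteqP; split => w [j jk Dj]; exists j.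
Qed.

End HitMeasurable.

(** * Summation by parts and Riemann sums *)

Section Sums.
Variable R : realType.

(** If [c] and [e] are read as distribution functions, [c <= e] means that [c] puts its mass later,
    where the decreasing [G] is smaller. *)
Lemma abel_increments_le (c e G : nat -> R) k n : (k <= n)%N ->
  c k = e k -> (forall j, (k <= j <= n)%N -> c j <= e j) ->
  (forall j, (k < j <= n)%N -> 0 <= G j) ->
  (forall i j, (k < i <= j)%N -> (j <= n)%N -> G j <= G i) ->
  \sum_(k.+1 <= j < n.+1) (c j - c j.-1) * G j <=
  \sum_(k.+1 <= j < n.+1) (e j - e j.-1) * G j.
Proof.
move=> kn cek ce G0 Gdec.
(* The boundary term of the summation by parts is kept so that the induction closes. At [n = k]
   nothing is assumed about [G n], but there its coefficient vanishes. *)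
suff : (e n - c n) * (if (k < n)%N then G n else 0) <=
    \sum_(k.+1 <= j < n.+1) (e j - e j.-1) * G j -
    \sum_(k.+1 <= j < n.+1) (c j - c j.-1) * G j.
  rewrite -[_ <= \sum_(_ <= j < _) (e j - _) * _]subr_ge0; apply: le_trans.
  rewrite mulr_ge0 //; first by rewrite subr_ge0 ce // kn /=.
  by case: ifP => // kn'; rewrite G0 // kn' /=.
elim: n kn ce G0 Gdec => [|n IHn] kn ce G0 Gdec.
  by rewrite ltn0 mulr0 !big_geq // subrr.
have [kE|kn'] := eqVneq k n.+1; first by rewrite -kE ltnn mulr0 !big_geq ?subrr.
have {}kn : (k <= n)%N by lia.
rewrite [X in _ <= X - _]big_nat_recr ?ltnS // [X in _ - X]big_nat_recr ?ltnS //= kn.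
set Se := (X in X + _ - _); set Sc := (X in _ - (X + _)).
rewrite [leRHS](_ : _ =
  (Se - Sc) + ((e n.+1 - c n.+1) - (e n - c n)) * G n.+1); last by ring.
have h : (e n - c n) * G n.+1 <= (e n - c n) * (if (k < n)%N then G n else 0).
  have [kn2|nk] := ltnP k n.
    by apply: ler_wpM2l; [rewrite subr_ge0 ce //; lia|apply: Gdec; lia].
  have -> : n = k by lia.
  by rewrite -cek subrr !mul0r.
have : (e n - c n) * G n.+1 <= Se - Sc.
  apply: le_trans h _; apply: IHn => //.
  - by move=> j jk; apply: ce; lia.
  - by move=> j jk; apply: G0; lia.
  - by move=> i j ij jn; apply: Gdec; lia.
lra.
Qed.

(** The integral of (r + 1) x^r over [b, a], bounded below by the value at the left end;
    algebraically, each of the r + 1 terms in the factorization of the difference is at least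
    b^r. *)
Lemma power_increment (a b : R) r : 0 <= b -> b <= a ->
  r.+1%:R * ((a - b) * b ^+ r) <= a ^+ r.+1 - b ^+ r.+1.
Proof.
move=> b0 ba; have a0 : 0 <= a by exact: le_trans ba.
rewrite subrXX mulrCA ler_wpM2l ?subr_ge0 //.
rewrite mulr_natl -[in leLHS](card_ord r.+1) -sumr_const.
apply: ler_sum => i _ /=.
have ir : r = (r - i + i)%N by rewrite subnK // -ltnS.
by rewrite {1}ir exprD ler_wpM2r ?exprn_ge0 // lerXn2r ?nnegrE.
Qed.

(** The left side is a lower Riemann sum of x^r / r! over the partition given by the decreasing [V].
    Iterating this integration produces the factorials of the final bound. *)
Lemma sum_power_increments_le (V : nat -> R) k n r : (k <= n)%N ->
  (forall j, (k <= j <= n)%N -> 0 <= V j) ->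
  (forall j, (k <= j < n)%N -> V j.+1 <= V j) ->
  \sum_(k.+1 <= j < n.+1) (V j.-1 - V j) * (V j ^+ r / r`!%:R) <=
  V k ^+ r.+1 / (r.+1)`!%:R.
Proof.
move=> kn V0 Vdec.
have f0 : 0 < (r.+1)`!%:R :> R by rewrite ltr0n fact_gt0.
have r0 : 0 < r`!%:R :> R by rewrite ltr0n fact_gt0.
suff : \sum_(k.+1 <= j < n.+1) (V j.-1 - V j) * (V j ^+ r / r`!%:R) <=
    (V k ^+ r.+1 - V n ^+ r.+1) / (r.+1)`!%:R.
  move=> /le_trans; apply; rewrite ler_pM2r ?invr_gt0 // lerBlDr lerDl.
  by rewrite exprn_ge0 // V0 // kn /=.
elim: n kn V0 Vdec => [|n IHn] kn V0 Vdec.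
  by rewrite big_geq // (_ : k = 0%N) ?subrr ?mul0r //; lia.
have [->|kn'] := eqVneq k n.+1; first by rewrite big_geq // subrr mul0r.
have {}kn : (k <= n)%N by lia.
rewrite big_nat_recr ?ltnS //=.
have -> : (V k ^+ r.+1 - V n.+1 ^+ r.+1) / (r.+1)`!%:R =
   (V k ^+ r.+1 - V n ^+ r.+1) / (r.+1)`!%:R +
   (V n ^+ r.+1 - V n.+1 ^+ r.+1) / (r.+1)`!%:R :> R by ring.
apply: lerD.
  by apply: IHn => // j jk; [apply: V0|apply: Vdec]; lia.
rewrite ler_pdivlMr //.
have -> : (r.+1)`!%:R = r.+1%:R * r`!%:R :> R by rewrite -natrM factS.
rewrite [leLHS](_ : _ * _ = r.+1%:R * ((V n - V n.+1) * V n.+1 ^+ r)).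
  by apply: power_increment; [apply: V0; lia|apply: Vdec; lia].
by field; rewrite gt_eqF.
Qed.

End Sums.

(** * Probability bounds for chains when past and future are independent *)

Section HoffmannJorgensen.
Context d (T : measurableType d) (R : realType) (P : probability T R).
Variables (D : nat -> nat -> T -> R) (SF SG : nat -> set (set T)) (n : nat).
Hypothesis D_ge0 : forall i j w, 0 <= D i j w.
Hypothesis Dii : forall i w, D i i w = 0.
Hypothesis DC : forall i j w, D i j w = D j i w.
Hypothesis D_triangle : forall i j k w, D i k w <= D i j w + D j k w.
Hypothesis SF_sub : forall k A, <<s SF k >> A -> measurable A.
Hypothesis SG_sub : forall k A, <<s SG k >> A -> measurable A.
Hypothesis D_SF : forall i j k, (i <= j <= k)%N ->
  measurable_fun [set: g_sigma_algebraType (SF k)] (D i j).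
Hypothesis D_SG : forall i j k, (k <= i <= j)%N ->
  measurable_fun [set: g_sigma_algebraType (SG k)] (D i j).
Hypothesis indep : forall k A B, <<s SF k >> A -> <<s SG k >> B ->
  Pr P (A `&` B) = Pr P A * Pr P B.

Local Notation hit := (hit D).
Local Notation hit_first := (hit_first D).
Local Notation completes := (completes D n).
Local Notation prob := (Pr P).

Let hitF k K a : <<s SF K >> (hit k K a).
Proof.
apply: (@measurable_hit _ (g_sigma_algebraType (SF K))) => j jk.
by apply: D_SF; lia.
Qed.

Let hitG k K a : <<s SG k >> (hit k K a).
Proof.
apply: (@measurable_hit _ (g_sigma_algebraType (SG k))) => j jk.
by apply: D_SG; lia.
Qed.

Let hit_firstF k j a : (k < j)%N -> <<s SF j >> (hit_first k a j).
Proof.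
move=> kj; apply: (@measurable_hit_first _ (g_sigma_algebraType (SF j))) => // i ki.
by apply: D_SF; lia.
Qed.

Let completesG k s : <<s SG k >> (completes k s).
Proof.
apply: (@measurable_completes _ (g_sigma_algebraType (SG k))) => i j ij.
exact: D_SG.
Qed.

Let mhit k K a : measurable (hit k K a).
Proof. exact: SF_sub (@hitF k K a). Qed.

Let mcompletes k s : measurable (completes k s).
Proof. exact: SG_sub (@completesG k s). Qed.

Let hit0 k a : hit k k a = set0.
Proof. by apply/seteqP; split => [w [j]|//]; lia. Qed.

Let hit_mono k K K' a : (K <= K')%N -> prob (hit k K a) <= prob (hit k K' a).
Proof.
move=> KK; apply: Pr_le => // w [j jk Dj]; exists j => //; lia.
Qed.

Lemma Pr_hit_first k a j : (k < j)%N ->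
  prob (hit_first k a j) = prob (hit k j a) - prob (hit k j.-1 a).
Proof.
case: j => // j kj /=; rewrite hitS // Pr_setU //.
- by rewrite addrAC subrr add0r.
- exact: SF_sub (@hit_firstF k _ a kj).
- by apply/seteqP; split => // w [h [_]].
Qed.

Lemma sum_Pr_hit_first k a : (k <= n)%N ->
  \sum_(k.+1 <= j < n.+1) (prob (hit k j a) - prob (hit k j.-1 a)) =
  prob (hit k n a).
Proof.
move=> kn; rewrite big_add1 /= telescope_sumr //.
by rewrite hit0 Pr_set0 subr0.
Qed.

(** Decomposition by the value [j] of the next stopping time: that it equals [j] is an event of the
    past of [j], the rest of the chain is an event of its future, and the probabilities multiply. *)
Lemma completes_step k a s (G : nat -> R) : (k <= n)%N ->
  (forall j, (k < j <= n)%N -> prob (completes j s) <= G j) ->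
  prob (completes k (a :: s)) <=
  \sum_(k.+1 <= j < n.+1) (prob (hit k j a) - prob (hit k j.-1 a)) * G j.
Proof.
move=> kn sG /=.
have [|_] := @Pr_exists_le _ _ _ P
    (fun j => hit_first k a j `&` completes j s) k n kn.
  move=> j /andP[kj _]; apply: measurableI => //.
  exact: SF_sub (@hit_firstF k _ a kj).
move=> /le_trans; apply; rewrite !big_nat; apply: ler_sum => j /andP[kj jn].
rewrite (indep (@hit_firstF k _ a kj) (@completesG j s)) -(Pr_hit_first a kj).
by rewrite ler_wpM2l ?Pr_ge0 // sG // kj.
Qed.

Section Threshold.
Variable t : R.
Hypothesis t_ge0 : 0 <= t.

(* If the walk stays within t of the origin up to time k and then moves by
   more than 2t, it leaves the ball of radius t: this is how an independent
   increment after k is compared with the walk itself. *)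
Lemma Pr_hit_increment k K : (k <= K)%N ->
  prob (hit k K (2 * t)) * (1 - prob (hit 0 k t)) <=
  prob (hit 0 K t) - prob (hit 0 k t).
Proof.
move=> kK.
have mC : measurable (~` hit 0 k t) by exact: measurableC.
have CF : <<s SF k >> (~` hit 0 k t).
  exact: (@measurableC _ (g_sigma_algebraType (SF k)) _ (@hitF 0 k t)).
rewrite lerBrDr -Pr_setC // mulrC -(indep CF (@hitG k K (2 * t))).
rewrite -Pr_setU //; last 2 first.
- exact: measurableI.
- by apply/seteqP; split => // w [[h _]].
apply: Pr_le => //; first by apply: measurableU => //; exact: measurableI.
move=> w [[nh [j /andP[kj jK] Dj]]|[j /andP[kj jK] Dj]]; last first.
  by exists j => //; lia.
exists j; first by lia.
have Dk : D 0 k w <= t.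
  have [->|k0] := posnP k; first by rewrite Dii.
  by rewrite leNgt; apply/negP => h; apply: nh; exists k => //; lia.
by have := D_triangle k 0 j w; rewrite (DC k 0); lra.
Qed.

Lemma Pr_hit_le1 k K a : prob (hit k K a) <= 1.
Proof. exact: Pr_le1. Qed.

(** With the notation of the proof, c (1 - h) <= u - h <= u (1 - h), and 1 - h cancels. If h = 1
    there is nothing to divide by, but then u >= h = 1. *)
Lemma Pr_hit_increment_le k : (k <= n)%N ->
  prob (hit k n (2 * t)) <= prob (hit 0 n t).
Proof.
move=> kn; have := Pr_hit_increment kn; have := hit_mono 0 t kn.
have := Pr_hit_le1 0 n t; have := Pr_hit_le1 k n (2 * t).
have := Pr_ge0 P (hit k n (2 * t)).
set c := prob (hit k n _); set h := prob (hit 0 k t); set u := prob (hit 0 n t).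
move=> c0 c1 u1 hu le; have [h1|h1] := eqVneq h 1.
  by rewrite (le_trans c1) // -h1.
have hlt : 0 < 1 - h by rewrite subr_gt0 lt_neqAle h1 (le_trans hu).
rewrite -(ler_pM2r hlt); apply: le_trans le _.
have : 0 <= h * (1 - u) by rewrite mulr_ge0 ?subr_ge0 ?Pr_ge0.
nra.
Qed.

Lemma completes_step_const k s B : (k <= n)%N -> 0 <= B ->
  (forall j, (k < j <= n)%N -> prob (completes j s) <= B) ->
  prob (completes k (2 * t :: s)) <= prob (hit 0 n t) * B.
Proof.
move=> kn B0 sB; apply: le_trans (completes_step _ kn sB) _.
by rewrite -mulr_suml sum_Pr_hit_first // ler_wpM2r // Pr_hit_increment_le.
Qed.

Lemma completes_block_const k s r B : (k <= n)%N -> 0 <= B ->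
  (forall j, (j <= n)%N -> prob (completes j s) <= B) ->
  prob (completes k (nseq r (2 * t) ++ s)) <= prob (hit 0 n t) ^+ r * B.
Proof.
move=> kn B0 sB; elim: r k kn => [|r IHr] k kn; first by rewrite expr0 mul1r sB.
rewrite exprS -mulrA; apply: completes_step_const => //.
  by rewrite mulr_ge0 ?exprn_ge0 ?Pr_ge0.
by move=> j /andP[_ jn]; exact: IHr.
Qed.

Lemma completes_first_const s B : 0 <= B ->
  (forall j, (j <= n)%N -> prob (completes j s) <= B) ->
  prob (completes 0 (t :: s)) <= prob (hit 0 n t) * B.
Proof.
move=> B0 sB; apply: le_trans (@completes_step 0 t s (fun=> B) _ _) _ => //.
  by move=> j /andP[_]; exact: sB.
by rewrite -mulr_suml sum_Pr_hit_first.
Qed.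

Let q := 1 - prob (hit 0 n t).
(** The probability that radius [t] is first exceeded after time [j] and by time [n], normalized by
    [q]. It decreases to 0 at [n] and serves as the integration variable of the factorial bound. *)
Let V j := (prob (hit 0 n t) - prob (hit 0 j t)) / q.
Hypothesis q_gt0 : 0 < q.

Let V_ge0 j : (j <= n)%N -> 0 <= V j.
Proof. by move=> jn; rewrite divr_ge0 ?(ltW q_gt0) // subr_ge0 hit_mono. Qed.

Let V_dec i j : (i <= j)%N -> V j <= V i.
Proof.
move=> ij; rewrite /V ler_pM2r ?invr_gt0 //.
by rewrite lerD2l lerN2 hit_mono.
Qed.

(** Lowering 1 - H k to [q], which is the same for every [k], dominates the distribution function of
    the next stopping time by (H j - H k) / q, whose increments are the decrements of [V]. The bound
    for the rest of the chain decreases in [j], so Abel summation permits the replacement, and the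
    Riemann sum raises the exponent by one. *)
Lemma completes_block_fact k s r B : (k <= n)%N -> 0 <= B ->
  (forall j, (j <= n)%N -> prob (completes j s) <= B) ->
  prob (completes k (nseq r (2 * t) ++ s)) <= B * (V k ^+ r / r`!%:R).
Proof.
move=> kn B0 sB; elim: r k kn => [|r IHr] k kn.
  by rewrite expr0 divr1 mulr1 sB.
have f0 : 0 <= r`!%:R^-1 :> R by rewrite invr_ge0.
apply: le_trans (completes_step (G := fun j => B * (V j ^+ r / r`!%:R)) _ kn _) _.
  by move=> j /andP[_ jn]; exact: IHr.
apply: le_trans (abel_increments_le
    (e := fun j => (prob (hit 0 j t) - prob (hit 0 k t)) / q) kn _ _ _ _) _.
- by rewrite hit0 Pr_set0 subrr mul0r.
- move=> j /andP[kj jn]; rewrite ler_pdivlMr //.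
  apply: le_trans (Pr_hit_increment kj); rewrite ler_wpM2l ?Pr_ge0 //.
  by rewrite /q lerD2l lerN2 hit_mono.
- by move=> j /andP[_ jn]; rewrite mulr_ge0 // mulr_ge0 // exprn_ge0 // V_ge0.
- move=> i j /andP[ki ij] jn; rewrite ler_wpM2l // ler_wpM2r //.
  by rewrite lerXn2r ?nnegrE ?V_ge0 ?V_dec //; lia.
rewrite (eq_bigr (fun j => B * ((V j.-1 - V j) * (V j ^+ r / r`!%:R)))); last first.
  by move=> j _; rewrite /V; ring.
rewrite -mulr_sumr ler_wpM2l //; apply: sum_power_increments_le => // j jk.
  by apply: V_ge0; lia.
exact: V_dec.
Qed.

(** The first threshold is [t] itself, so the increments of the law of its stopping time are exactly
    [q] times the decrements of [V]; this is the origin of the factor [q]. *)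
Lemma completes_first_fact s r B : 0 <= B ->
  (forall j, (j <= n)%N -> prob (completes j s) <= B) ->
  prob (completes 0 (t :: nseq r (2 * t) ++ s)) <=
  q * (B * (V 0 ^+ r.+1 / (r.+1)`!%:R)).
Proof.
move=> B0 sB.
apply: le_trans (completes_step (G := fun j => B * (V j ^+ r / r`!%:R)) _ _ _) _ => //.
  by move=> j /andP[_ jn]; exact: completes_block_fact.
rewrite (eq_bigr (fun j => q * B * ((V j.-1 - V j) * (V j ^+ r / r`!%:R)))); last first.
  move=> j _; rewrite /V; field.
  by rewrite (gt_eqF q_gt0) pnatr_eq0 -lt0n fact_gt0.
rewrite -mulr_sumr -mulrA ler_wpM2l ?(ltW q_gt0) // ler_wpM2l //.
apply: sum_power_increments_le => // j jk.
exact: V_dec.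
Qed.

End Threshold.

Variables (n_ : nat -> nat) (t : nat -> R) (small : pred nat).
Local Notation u j := (prob (hit 0 n (t j))).
Local Notation blocks js := (flatten [seq nseq (n_ j) (2 * t j) | j <- js]).

(** Blocks are peeled off from the front, each with the bound that [small] selects for it. This
    composes because the bound for the remaining blocks is uniform in the starting time; for the
    factorial bound, [V k] is enlarged to [u j / (1 - u j)]. *)
Lemma completes_blocks (js : seq nat) k : (k <= n)%N ->
  (forall j, j \in js -> 0 <= t j) ->
  (forall j, j \in js -> ~~ small j -> 0 < 1 - u j) ->
  prob (completes k (blocks js)) <=
  \prod_(j <- js) (if small j then u j ^+ n_ j
                   else 1 / (n_ j)`!%:R * (u j / (1 - u j)) ^+ n_ j).
Proof.
move=> kn; elim: js k kn => [|j js IHjs] k kn t0 q0.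
  by rewrite big_nil Pr_le1.
have sB i : (i <= n)%N -> prob (completes i (blocks js)) <=
    \prod_(j <- js) (if small j then u j ^+ n_ j
                     else 1 / (n_ j)`!%:R * (u j / (1 - u j)) ^+ n_ j).
  move=> iN; apply: IHjs => // i' ij; first by rewrite t0 // inE ij orbT.
  by apply: q0; rewrite inE ij orbT.
set B := \prod_(_ <- js) _ in sB.
have B0 : 0 <= B by rewrite (le_trans _ (sB n _)) // Pr_ge0.
have tj : 0 <= t j by rewrite t0 ?mem_head.
rewrite /= big_cons -/B; case: ifPn => sj; first exact: completes_block_const.
have qj : 0 < 1 - u j by rewrite q0 ?mem_head.
apply: le_trans (completes_block_fact tj qj _ kn B0 sB) _.
rewrite mulrC ler_wpM2r // mulrC div1r ler_wpM2l ?invr_ge0 //.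
rewrite lerXn2r ?nnegrE ?divr_ge0 ?(ltW qj) ?subr_ge0 ?hit_mono ?Pr_ge0 //.
by rewrite ler_pM2r ?invr_gt0 // lerBlDr lerDl Pr_ge0.
Qed.

Lemma completes_all_blocks (js : seq nat) i : (0 < n_ i)%N ->
  (forall j, j \in i :: js -> 0 <= t j) ->
  (forall j, j \in i :: js -> ~~ small j -> 0 < 1 - u j) ->
  prob (completes 0 (t i :: nseq (n_ i).-1 (2 * t i) ++ blocks js)) <=
  (1 - u i) ^+ (~~ small i) *
  \prod_(j <- i :: js) (if small j then u j ^+ n_ j
                   else 1 / (n_ j)`!%:R * (u j / (1 - u j)) ^+ n_ j).
Proof.
move=> ni t0 q0.
have sB k : (k <= n)%N -> prob (completes k (blocks js)) <=
    \prod_(j <- js) (if small j then u j ^+ n_ j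
                     else 1 / (n_ j)`!%:R * (u j / (1 - u j)) ^+ n_ j).
  move=> kn; apply: completes_blocks => // j ij; first by rewrite t0 // inE ij orbT.
  by apply: q0; rewrite inE ij orbT.
set B := \prod_(_ <- js) _ in sB.
have B0 : 0 <= B by rewrite (le_trans _ (sB n _)) // Pr_ge0.
have ti : 0 <= t i by rewrite t0 ?mem_head.
rewrite big_cons -/B; case: ifPn => si /=.
  rewrite expr0 mul1r -[in leRHS](prednK ni) exprS -mulrA.
  apply: completes_first_const => [|k kn].
    by rewrite mulr_ge0 ?exprn_ge0 ?Pr_ge0.
  exact: completes_block_const.
have qi : 0 < 1 - u i by rewrite q0 ?mem_head.
apply: le_trans (completes_first_fact ti qi _ B0 sB) _.
rewrite prednK // expr1 ler_wpM2l ?(ltW qi) // mulrC ler_wpM2r //.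
rewrite (_ : hit 0 0 _ = set0) ?hit0 // Pr_set0 subr0.
by rewrite mulrC div1r.
Qed.

End HoffmannJorgensen.

(** * Factoring the walk through a product of matrices *)

Section Frames.
Variables (R : realType) (m : nat).
Implicit Types x : nat -> 'M[R]_m.

(** Shifted by one against [walk]: index 0 is the identity from which the walk starts, so that one
    recursion formula covers every step. *)
Definition sqrt_walk x j : 'M[R]_m := if j is i.+1 then sqrtmx (walk x i) else 1%:M.

(* [frame x j = g_0 ... g_(j-1)] with [g_i = sqrtmx (rotated x i)] satisfies
   [frame x j *m (frame x j)^T = S_j], so [frame x j] and the square sqrt_walk of
   [S_j] differ by the orthogonal factor [rot x j], which only depends on
   [x 0, ..., x (j-1)]. *)
Fixpoint frame x j : 'M[R]_m :=
  if j is i.+1 then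
    let k := invmx (frame x i) *m sqrt_walk x i in
    frame x i *m sqrtmx (k *m x i *m k^T)
  else 1%:M.

Definition rot x j := invmx (frame x j) *m sqrt_walk x j.

Definition rotated x j := rot x j *m x j *m (rot x j)^T.

Lemma frameS x j : frame x j.+1 = frame x j *m sqrtmx (rotated x j).
Proof. by []. Qed.

Definition gap x i j := mxlen (invmx (frame x i) *m frame x j).

Lemma walkE x j : walk x j = sqrt_walk x j *m x j *m sqrt_walk x j.
Proof. by case: j => [|j] //=; rewrite mul1mx mulmx1. Qed.

Section PositiveSteps.
Variable x : nat -> 'M[R]_m.
Hypothesis xP : forall i, posdefmx (x i).

Lemma walk_posdef j : posdefmx (walk x j).
Proof.
elim: j => [|j IHj] /=; first exact: xP.
have [[sT sp] _] := sqrtmxP IHj.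
rewrite -[X in _ *m X]sT; apply: posdef_congr => //.
by apply: posdef_unit; split.
Qed.

Lemma sqrt_walk_posdef j : posdefmx (sqrt_walk x j).
Proof.
case: j => [|j]; first exact: posdef1.
by have [] := sqrtmxP (walk_posdef j).
Qed.

Lemma sqrt_walk_sq j : sqrt_walk x j.+1 *m sqrt_walk x j.+1 = walk x j.
Proof. by have [] := sqrtmxP (walk_posdef j). Qed.

Lemma frame_gram j : frame x j \in unitmx /\
  frame x j *m (frame x j)^T = sqrt_walk x j *m sqrt_walk x j.
Proof.
elim: j => [|j [IHu IHg]]; first by rewrite unitmx1 /= trmx1.
have rT : (sqrt_walk x j)^T = sqrt_walk x j by have [] := sqrt_walk_posdef j.
have ku : rot x j \in unitmx.
  by rewrite unitmx_mul unitmx_inv IHu posdef_unit //; exact: sqrt_walk_posdef.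
have [gp gg] := sqrtmxP (posdef_congr (xP j) ku : posdefmx (rotated x j)).
have [gT _] := gp.
rewrite frameS; split; first by rewrite unitmx_mul IHu posdef_unit.
rewrite trmx_mul gT -!mulmxA (mulmxA (sqrtmx _)) gg sqrt_walk_sq.
rewrite walkE /rotated /rot trmx_mul trmx_inv rT !mulmxA mulmxV // mul1mx.
by rewrite -!mulmxA -trmx_inv -trmx_mul mulmxV // trmx1 mulmx1.
Qed.

Lemma frame_unit j : frame x j \in unitmx.
Proof. by have [] := frame_gram j. Qed.

Lemma rot_orth j : orthomx (rot x j).
Proof.
have [u g] := frame_gram j; have [rT _] := sqrt_walk_posdef j.
rewrite /orthomx /rot trmx_mul rT mulmxA -(mulmxA _ (sqrt_walk x j) (sqrt_walk x j)) -g.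
by rewrite mulmxA mulVmx // mul1mx trmx_inv mulmxV // unitmx_tr.
Qed.

Lemma rotated_posdef j : posdefmx (rotated x j).
Proof. by apply: posdef_congr => //; apply/orthomx_unit/rot_orth. Qed.

Lemma gap_ge0 i j : 0 <= gap x i j.
Proof. exact: mxlen_ge0. Qed.

Lemma gapii i : gap x i i = 0.
Proof. by rewrite /gap mulVmx ?mxlen1 // frame_unit. Qed.

Lemma gapC i j : gap x i j = gap x j i.
Proof.
rewrite /gap -mxlenV; last by rewrite unitmx_mul unitmx_inv !frame_unit.
congr mxlen; apply: invmx_uniq.
by rewrite mulmxA -(mulmxA _ (frame x j)) mulmxV ?mulmx1 ?mulVmx ?frame_unit.
Qed.

Lemma gap_triangle i j k : gap x i k <= gap x i j + gap x j k.
Proof.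
rewrite /gap (_ : invmx (frame x i) *m frame x k =
  (invmx (frame x i) *m frame x j) *m (invmx (frame x j) *m frame x k)).
  by apply: mxlenM; rewrite unitmx_mul unitmx_inv !frame_unit.
by rewrite mulmxA -(mulmxA _ (frame x j)) mulmxV ?frame_unit // mulmx1.
Qed.

Lemma gap0 j : gap x 0 j.+1 = dR 1%:M (walk x j).
Proof.
rewrite /gap /mxlen [frame x 0]/= invmx1 mul1mx.
by have [_ ->] := frame_gram j.+1; rewrite sqrt_walk_sq.
Qed.

Lemma gap_succ j : gap x j j.+1 = dR 1%:M (x j).
Proof.
rewrite /gap frameS mulKmx; last exact: frame_unit.
rewrite /mxlen.
have [[-> _] ->] := sqrtmxP (rotated_posdef j).
by apply: dR1_char_poly; rewrite char_poly_orth //; exact: rot_orth.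
Qed.

End PositiveSteps.

Section MeasurableFrames.
Context d (T : measurableType d).
Variable X : T -> nat -> 'M[R]_m.
Hypothesis XP : forall w i, posdefmx (X w i).

Lemma mxmeas_walk k : (forall i, (i <= k)%N -> mxmeas (fun w => X w i)) ->
  mxmeas (fun w => walk (X w) k).
Proof.
elim: k => [|k IHk] mX /=; first exact: mX.
have mW : mxmeas (fun w => sqrtmx (walk (X w) k)).
  apply: mxmeas_sqrtmx => [w|]; first exact: walk_posdef.
  by apply: IHk => i ik; apply: mX; lia.
by apply: mxmeasM => //; apply: mxmeasM => //; exact: mX.
Qed.

Lemma mxmeas_sqrt_walk k : (forall i, (i < k)%N -> mxmeas (fun w => X w i)) ->
  mxmeas (fun w => sqrt_walk (X w) k).
Proof.
case: k => [|k] mX /=; first exact: mxmeas_cst.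
apply: mxmeas_sqrtmx => [w|]; first exact: walk_posdef.
exact: mxmeas_walk.
Qed.

Lemma mxmeas_frame k : (forall i, (i < k)%N -> mxmeas (fun w => X w i)) ->
  mxmeas (fun w => frame (X w) k).
Proof.
elim: k => [|k IHk] mX; first exact: mxmeas_cst.
have mk i : (i < k)%N -> mxmeas (fun w => X w i) by move=> ik; apply: mX; lia.
have mF := IHk mk.
have mR : mxmeas (fun w => rot (X w) k).
  apply: mxmeasM; last exact: mxmeas_sqrt_walk.
  by apply: mxmeasV => // w; exact: frame_unit.
apply: mxmeasM => //; apply: mxmeas_sqrtmx => [w|]; first exact: rotated_posdef.
by apply: mxmeasM; [apply: mxmeasM => //; exact: mX|exact: mxmeasT].
Qed.

Lemma mxmeas_rot k : (forall i, (i < k)%N -> mxmeas (fun w => X w i)) ->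
  mxmeas (fun w => rot (X w) k).
Proof.
move=> mX; apply: mxmeasM; last exact: mxmeas_sqrt_walk.
by apply: mxmeasV => [w|]; [exact: frame_unit|exact: mxmeas_frame].
Qed.

Lemma mxmeas_rotated k : (forall i, (i <= k)%N -> mxmeas (fun w => X w i)) ->
  mxmeas (fun w => rotated (X w) k).
Proof.
move=> mX; have mR : mxmeas (fun w => rot (X w) k).
  by apply: mxmeas_rot => i ik; apply: mX; lia.
by apply: mxmeasM; [apply: mxmeasM => //; exact: mX|exact: mxmeasT].
Qed.

Lemma measurable_mxlen (F : T -> 'M[R]_m) : (forall w, F w \in unitmx) ->
  mxmeas F -> measurable_fun setT (fun w => mxlen (F w)).
Proof.
move=> Fu mF; apply: measurable_dR1 => [w|]; first exact: posdef_gram.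
by apply: mxmeasM => //; exact: mxmeasT.
Qed.

Lemma measurable_gap_past i j k : (i <= j <= k)%N ->
  (forall q, (q < k)%N -> mxmeas (fun w => X w q)) ->
  measurable_fun setT (fun w => gap (X w) i j).
Proof.
move=> ijk mX; apply: measurable_mxlen => [w|].
  by rewrite unitmx_mul unitmx_inv !frame_unit.
apply: mxmeasM; last by apply: mxmeas_frame => q qj; apply: mX; lia.
apply: mxmeasV => [w|]; first exact: frame_unit.
by apply: mxmeas_frame => q qi; apply: mX; lia.
Qed.

(** Both frames involve earlier steps, but the frame at [i] cancels and leaves the product of the
    square roots of the rotated steps from [i] to [j - 1]. *)
Lemma measurable_gap_future i j k : (k <= i <= j)%N ->
  (forall q, (k <= q)%N -> mxmeas (fun w => rotated (X w) q)) ->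
  measurable_fun setT (fun w => gap (X w) i j).
Proof.
move=> /andP[ki ij] mX; apply: measurable_mxlen => [w|].
  by rewrite unitmx_mul unitmx_inv !frame_unit.
rewrite -(subnKC ij); elim: (j - i)%N => [|q IHq].
  rewrite addn0; apply: mxmeas_ext (mxmeas_cst 1%:M) => w.
  by rewrite mulVmx // frame_unit.
rewrite addnS; under eq_fun do rewrite frameS mulmxA.
apply: mxmeasM => //; apply: mxmeas_sqrtmx => [w|]; first exact: rotated_posdef.
by apply: mX; lia.
Qed.

End MeasurableFrames.
End Frames.

(** * Independence of the rotated steps *)

Section PiSystems.
Context d (T : measurableType d) (R : realType) (P : probability T R).

Lemma sigma_sub_measurable (G : set (set T)) : G `<=` measurable ->
  <<s G >> `<=` measurable.
Proof. by move=> Gm; apply: smallest_sub => //; exact: sigma_algebra_measurable. Qed.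

(** Dynkin's argument: the sets [A] obeying the product formula with [E] are stable under complement
    and countable disjoint union. *)
Lemma pi_system_indep (G : set (set T)) (E : set T) :
  setI_closed G -> G `<=` measurable -> measurable E ->
  (forall A, G A -> P (A `&` E) = (P A * P E)%E) ->
  forall A, <<s G >> A -> P (A `&` E) = (P A * P E)%E.
Proof.
move=> GI Gm mE GE; have sGm := sigma_sub_measurable Gm.
have PEfin : P E \is a fin_num by exact: fin_num_measure.
have compl (A : set T) : measurable A -> P (A `&` E) = (P A * P E)%E ->
    P (~` A `&` E) = (P (~` A) * P E)%E.
  move=> mA PA; rewrite (setIC _ E) -setDE measureD //; last first.
    by rewrite -ge0_fin_numE.
  transitivity (P E - P A * P E)%E; first by rewrite (setIC E A) -PA.
  rewrite probability_setC // muleBl ?mul1e //.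
have union (A : nat -> set T) : (forall k, measurable (A k)) -> trivIset setT A ->
    (forall k, P (A k `&` E) = (P (A k) * P E)%E) ->
    P (\bigcup_k A k `&` E) = (P (\bigcup_k A k) * P E)%E.
  move=> mA tA PA; rewrite setI_bigcupl !measure_semi_bigcup //.
  - have Ec : P E = (fine (P E))%:E by rewrite fineK.
    rewrite [in RHS]Ec muleC -nneseriesZl //; apply: eq_eseriesr => k _.
    by rewrite -Ec muleC; exact: PA.
  - exact: bigcup_measurable.
  - by move=> k; exact: measurableI.
  - exact: trivIset_setIr.
  - by apply: bigcup_measurable => k _; exact: measurableI.
apply: (@dynkin_induction _ (g_sigma_algebraType G)) => //.
- by rewrite setTI probability_setT mul1e.
- by move=> A /sGm mA PA; exact: compl.
- by move=> A mA tA PA; apply: union => // k; exact: sGm (mA k).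
Qed.

End PiSystems.

Section EntryAlgebra.
Variables (R : realType) (m : nat).

(* All the functions of matrices used below are measurable for this
   sigma-algebra; that it is the whole Borel sigma-algebra is not needed. *)
Definition entry_sets : set (set 'M[R]_m) :=
  [set S | exists (i j : 'I_m) (B : set R),
    measurable B /\ S = (fun M : 'M[R]_m => M i j) @^-1` B].

Definition entrymx : measurableType _ := g_sigma_algebraType entry_sets.

Lemma entrymx_measurable_fun d (T : measurableType d) (F : T -> 'M[R]_m) :
  mxmeas F -> measurable_fun setT (F : T -> entrymx).
Proof.
move=> mF; apply: (@measurability _ _ T entrymx setT F entry_sets) => //.
by move=> _ [_ [i [j [B [mB ->]]]] <-]; exact: mF.
Qed.

Lemma mxmeas_comp_entrymx d (T : measurableType d) (F : T -> entrymx) :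
  measurable_fun setT F -> mxmeas (F : T -> 'M[R]_m).
Proof.
move=> mF i j _ B mB; apply: (mF _ ((fun M : 'M[R]_m => M i j) @^-1` B)) => //.
by apply: sub_sigma_algebra; exists i, j, B.
Qed.

Lemma entrymx_borelmx (B : set 'M[R]_m) :
  @measurable _ entrymx B -> @measurable _ (borelmx R m) B.
Proof.
apply: smallest_sub => [|_ [i [j [S [mS ->]]]]].
  exact: (@sigma_algebra_measurable _ (borelmx R m)).
have mc : measurable_fun setT (fun M : borelmx R m => (M : 'M[R]_m) i j).
  apply: (@measurability _ _ (borelmx R m) _ setT
    (fun M : borelmx R m => (M : 'M[R]_m) i j) _ (RGenOInfty.measurableE R)) => //.
  move=> _ [_ [x ->] <-]; rewrite setTI; apply: sub_sigma_algebra.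
  apply: open_comp => [M _|]; first exact: coord_continuous.
  rewrite (_ : `]x, +oo[%classic = [set y | x < y]); first exact: open_gt.
  by apply/seteqP; split => y /=; rewrite in_itv /= andbT.
by rewrite -[X in measurable X]setTI; exact: mc.
Qed.

Lemma mxmeas_RV d (T : measurableType d) (P : probability T R)
    (X : {RV P >-> borelmx R m}) : mxmeas (fun w => X w : 'M[R]_m).
Proof.
apply: mxmeas_comp_entrymx => _ B mB.
have : measurable ([set: T] `&` (X : T -> borelmx R m) @^-1` B).
  by apply: (measurable_funPT X) => //; exact: entrymx_borelmx.
by [].
Qed.

End EntryAlgebra.

Section Cylinders.
Context (T : Type) (R : realType) (m : nat) (Y : nat -> T -> 'M[R]_m).

Definition cylinder a b : set (set T) :=
  [set A | exists B : nat -> set 'M[R]_m,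
    (forall i, @measurable _ (entrymx R m) (B i)) /\
    A = [set w | forall i, (a <= i < b)%N -> B i (Y i w)]].

Definition future_cylinder a : set (set T) := \bigcup_b cylinder a b.

Lemma cylinder_widen a b c : (b <= c)%N -> cylinder a b `<=` cylinder a c.
Proof.
move=> bc _ [B [mB ->]].
exists (fun i => if (i < b)%N then B i else setT); split.
  by move=> i; case: ifP => // _; exact: measurableT.
apply/seteqP; split => w h i /andP[ai ib].
  by case: ifPn => // ib'; apply: h; rewrite ai.
by have := h i; rewrite ai ib (leq_trans ib bc) => /(_ isT).
Qed.

Lemma cylinder_setI a b : setI_closed (cylinder a b).
Proof.
move=> _ _ [B [mB ->]] [C [mC ->]]; exists (fun i => B i `&` C i); split.
  by move=> i; exact: measurableI.
apply/seteqP; split => [w [h h'] i ai|w h]; first by split; [exact: h|exact: h'].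
by split => i /h [].
Qed.

Lemma future_cylinder_setI a : setI_closed (future_cylinder a).
Proof.
move=> A B [b _ Ab] [c _ Bc]; exists (maxn b c) => //.
apply: cylinder_setI.
  by apply: cylinder_widen Ab; exact: leq_maxl.
by apply: cylinder_widen Bc; exact: leq_maxr.
Qed.

Lemma cylinder_preimage a b i (B : set 'M[R]_m) : (a <= i < b)%N ->
  @measurable _ (entrymx R m) B -> cylinder a b (Y i @^-1` B).
Proof.
move=> aib mB; exists (fun j => if j == i then B else setT); split.
  by move=> j; case: ifP => // _; exact: measurableT.
apply/seteqP; split => w /= h; last by have := h i aib; rewrite eqxx.
by move=> j _; case: eqP => // ->.
Qed.

Lemma cylinderS a b (B : nat -> set 'M[R]_m) : (a <= b)%N ->
  [set w | forall i, (a <= i < b.+1)%N -> B i (Y i w)] =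
  [set w | forall i, (a <= i < b)%N -> B i (Y i w)] `&` Y b @^-1` B b.
Proof.
move=> ab; apply/seteqP; split => [w h|w [h hb] i ai].
  by split => [i ai|]; apply: h; lia.
by have [->//|ib] := eqVneq i b; apply: h; lia.
Qed.

End Cylinders.

Section CylinderMeasurable.
Context d (T : pointedType) (T' : measurableType d) (R : realType) (m : nat).

Lemma mxmeas_cylinder (Y : nat -> T -> 'M[R]_m) (G : set (set T)) a b i :
  (a <= i < b)%N -> cylinder Y a b `<=` G ->
  mxmeas (Y i : g_sigma_algebraType G -> 'M[R]_m).
Proof.
move=> aib YG; apply: mxmeas_comp_entrymx => _ B mB; rewrite setTI.
by apply: sub_sigma_algebra; apply: YG; exact: cylinder_preimage.
Qed.

Lemma cylinder_measurable (Y : nat -> T' -> 'M[R]_m) a b :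
  (forall i, (a <= i < b)%N -> mxmeas (Y i)) -> cylinder Y a b `<=` measurable.
Proof.
move=> mY _ [B [mB ->]]; elim: b mY => [|b IHb] mY.
  rewrite (_ : mkset _ = setT); first exact: measurableT.
  by apply/seteqP; split => // w _ i; lia.
have [ab|ba] := leqP a b; last first.
  rewrite (_ : mkset _ = setT); first exact: measurableT.
  by apply/seteqP; split => // w _ i; lia.
rewrite cylinderS //; apply: measurableI.
  by apply: IHb => i aib; apply: mY; lia.
rewrite -[X in measurable X]setTI; apply: (entrymx_measurable_fun (mY b _)) => //.
by rewrite ab /=.
Qed.

End CylinderMeasurable.

Section Decoupling.
Context d (T : measurableType d) (R : realType) (P : probability T R) (m : nat).
Variable X : nat -> {RV P >-> borelmx R m}.
Hypothesis XP : forall i w, posdefmx (X i w : 'M[R]_m).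
Hypothesis X_indep : mutually_independent X.
Hypothesis X_orth : forall i, orthogonally_invariant (X i).

Let Y i w : 'M[R]_m := X i w.
Let x w i : 'M[R]_m := X i w.
Let x' i w : 'M[R]_m := rotated (x w) i.
Let past k := cylinder Y 0 k.

Let mY i : mxmeas (Y i).
Proof. exact: mxmeas_RV. Qed.

Let past_measurable k : past k `<=` measurable.
Proof. by apply: cylinder_measurable => i _; exact: mY. Qed.

Let mY_preimage i B : @measurable _ (entrymx R m) B -> measurable (Y i @^-1` B).
Proof.
by move=> mB; rewrite -[X in measurable X]setTI; apply: (entrymx_measurable_fun (mY i)).
Qed.

Let P_cylinder k (B : nat -> set 'M[R]_m) :
  (forall i, @measurable _ (entrymx R m) (B i)) ->
  Pr P [set w | forall i, (0 <= i < k)%N -> B i (Y i w)] =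
  \prod_(0 <= i < k) Pr P (Y i @^-1` B i).
Proof.
move=> mB.
have := X_indep (iota_uniq 0 k) (fun i => entrymx_borelmx (mB i)).
rewrite /index_iota subn0 => <-; congr Pr.
apply/seteqP; split => w h i /=.
  by rewrite mem_iota add0n => ik; exact: h.
by move=> ik; apply: h => /=; rewrite mem_iota.
Qed.

Let past_indep k A B : <<s past k >> A -> @measurable _ (entrymx R m) B ->
  (P (A `&` Y k @^-1` B) = P A * P (Y k @^-1` B))%E.
Proof.
move=> sA mB; move: A sA; apply: pi_system_indep => //.
- exact: cylinder_setI.
- exact: mY_preimage.
move=> A PA; have [C [mC AC]] := PA.
have mA : measurable A by exact: (@past_measurable k).
pose C' i := if i == k then B else C i.
have mC' i : @measurable _ (entrymx R m) (C' i).
  by rewrite /C'; case: ifP => _; [exact: mB|exact: mC].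
have E : A `&` Y k @^-1` B = [set w | forall i, (0 <= i < k.+1)%N -> C' i (Y i w)].
  rewrite cylinderS // /C' eqxx AC; congr (_ `&` _).
  by apply/seteqP; split => w h i ik; have := h i ik; rewrite ltn_eqF //; lia.
have mE : measurable (A `&` Y k @^-1` B) by apply: measurableI => //; exact: mY_preimage.
rewrite !(PrE P) //; last exact: mY_preimage.
rewrite -EFinM E P_cylinder // big_nat_recr //= /C' eqxx; congr (_ * _)%:E.
rewrite AC P_cylinder // !big_nat; apply: eq_bigr => i ik.
by rewrite ltn_eqF.
Qed.

Let mx_past k i : (i < k)%N ->
  mxmeas ((fun w => x w i) : g_sigma_algebraType (past k) -> 'M[R]_m).
Proof. by move=> ik; apply: (@mxmeas_cylinder _ _ _ Y _ 0 k). Qed.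

(* Given the past the rotation is fixed, and the next step is independent of
   the past with an orthogonally invariant law. *)
Let rotated_step k A B : <<s past k >> A -> @measurable _ (entrymx R m) B ->
  (P (A `&` x' k @^-1` B) = P A * P (Y k @^-1` B))%E.
Proof.
move=> sA mB.
(* The past is represented by the point [w] itself under the coarser sigma-algebra. Independence
   says that the pair ([w], step [k]) has a product law, so the event can be integrated with [w],
   and with it the rotation, held fixed. *)
pose TF := g_sigma_algebraType (past k).
have mid : measurable_fun setT (id : T -> TF).
  by move=> _ S mS; rewrite setTI; apply: (sigma_sub_measurable (@past_measurable k)).
have mYk := entrymx_measurable_fun (mY k).
pose idF : {mfun T >-> TF} := mfun_Sub (mem_set mid).
pose Yk : {mfun T >-> entrymx R m} := mfun_Sub (mem_set mYk).
pose m1 := distribution P idF; pose m2 := distribution P Yk.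
have mpair : measurable_fun setT (fun w => (w, Y k w) : TF * entrymx R m).
  exact: measurable_fun_pair.
pose pr : {mfun T >-> (TF * entrymx R m)%type} := mfun_Sub (mem_set mpair).
pose m' := distribution P pr.
have law S : measurable S -> (m1 \x m2)%E S = m' S.
  apply: product_measure_unique => A1 A2 mA1 mA2; exact: past_indep.
pose C := (fst : TF * entrymx R m -> TF) @^-1` A `&`
  (fun z : TF * entrymx R m =>
     rot (x z.1) k *m (z.2 : 'M[R]_m) *m (rot (x z.1) k)^T) @^-1` B.
have mxF : mxmeas (fun z : TF * entrymx R m =>
    rot (x z.1) k *m (z.2 : 'M[R]_m) *m (rot (x z.1) k)^T).
  have mrot : mxmeas (fun z : TF * entrymx R m => rot (x z.1) k).
    move=> i j; apply: (@measurableT_comp _ _ _ _ _ _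
      ((fun w => rot (x w) k i j) : TF -> R) _ fst) => //.
    by move: i j; apply: mxmeas_rot => [w q|q qk]; [exact: XP|exact: mx_past].
  apply: mxmeasM; last exact: mxmeasT.
  apply: mxmeasM => //; apply: mxmeas_comp_entrymx; exact: measurable_snd.
have mC : measurable C.
  apply: measurableI.
    rewrite -[X in measurable X]setTI.
    exact: (@measurable_fst _ _ TF (entrymx R m) measurableT A sA).
  by rewrite -[X in measurable X]setTI; exact: (entrymx_measurable_fun mxF measurableT mB).
transitivity (m' C); first by [].
rewrite -law //.
transitivity ((m1 \x m2)%E (A `*` B)); last first.
  by rewrite law; [exact: past_indep|exact: measurableX].
(* It is enough to compare sections at each [w]: both are empty off [A], and on [A] they differ by
   the fixed rotation, which orthogonal invariance removes. *)
rewrite /product_measure1; apply: eq_integral => w _ /=.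
have [Aw|nAw] := boolP (w \in A); last first.
  rewrite notin_xsectionX // (_ : xsection C w = set0) //.
  apply/seteqP; split => // M; rewrite /xsection /= inE => -[Aw _].
  by case/negP: nAw; exact: mem_set.
rewrite in_xsectionX // /m2 /distribution /pushforward /=.
transitivity (P [set w' | B (rot (x w) k *m Y k w' *m (rot (x w) k)^T)]).
  congr (P _); apply/seteqP; split => w' /=; rewrite /xsection /= inE; first by case.
  by split => //; rewrite inE in Aw.
by apply: X_orth; [apply: rot_orth => i; exact: XP|exact: entrymx_borelmx].
Qed.

Let mx' k i : (i < k)%N ->
  mxmeas (x' i : g_sigma_algebraType (past k) -> 'M[R]_m).
Proof.
move=> ik; apply: mxmeas_rotated => [w q|q qi]; first exact: XP.
by apply: mx_past; lia.
Qed.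

(** Future cylinders are built one step at a time. The part [F] of the cylinder before step [b] lies
    in the past of [b], so [rotated_step] splits off the same factor from [A] intersected with [F]
    and from [F] alone. *)
Lemma past_future_indep k A E : <<s past k >> A ->
  <<s future_cylinder x' k >> E -> Pr P (A `&` E) = Pr P A * Pr P E.
Proof.
move=> sA sE.
have past_sub j S : <<s past j >> S -> measurable S.
  exact: sigma_sub_measurable.
have mA := past_sub _ _ sA.
have mx'T i : mxmeas (x' i : T -> 'M[R]_m).
  by apply: mxmeas_rotated => [w q|q qi]; [exact: XP|exact: mY].
have fut_sub : future_cylinder x' k `<=` measurable.
  by move=> S [b _]; apply: cylinder_measurable => i _; exact: mx'T.
have mE := sigma_sub_measurable fut_sub sE.
suff : (P (E `&` A) = P E * P A)%E.
  rewrite !(PrE P) //; last exact: measurableI.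
  by rewrite -EFinM => -[]; rewrite setIC mulrC.
move: E sE mE; move=> E sE _; move: E sE; apply: pi_system_indep => //.
  exact: future_cylinder_setI.
move=> E [b _ [B [mB ->]]]; rewrite setIC muleC.
elim: b => [|b IHb].
  rewrite (_ : mkset _ = setT); first by rewrite setIT probability_setT mule1.
  by apply/seteqP; split => // w _ i; lia.
have [kb|bk] := leqP k b; last first.
  rewrite (_ : mkset _ = setT); first by rewrite setIT probability_setT mule1.
  by apply/seteqP; split => // w _ i; lia.
rewrite cylinderS //; set F := [set w | _] in IHb *.
have sF : <<s past b >> F.
  have : cylinder x' k b F by exists B.
  apply: (@cylinder_measurable _ (g_sigma_algebraType (past b))) => i ib.
  by apply: mx'; lia.
have sAb : <<s past b >> A.
  move: A sA {mA IHb}; apply: sub_sigma_algebra2 => //.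
  by apply: cylinder_widen.
have sAF : <<s past b >> (A `&` F).
  exact: (@measurableI _ (g_sigma_algebraType (past b))).
by rewrite setIA (rotated_step sAF (mB b)) (rotated_step sF (mB b)) IHb muleA.
Qed.

End Decoupling.

(** * Order statistics and the final bound *)

Section OrderStatistics.
Variable R : realType.
Implicit Types s : seq R.

Definition top_sum s k := \sum_(size s - k <= i < size s) nth 0 (sort <=%R s) i.

(* Compare both sides with the k-th largest entry c: sum_I (y_i - c) is at
   most sum_i max (y_i - c) 0, which is attained by the k largest entries. *)
Lemma sum_le_top_sum s k (I : seq nat) : (k <= size s)%N ->
  (forall y, y \in s -> 0 <= y) -> uniq I -> all (fun i => i < size s)%N I ->
  (size I <= k)%N -> \sum_(i <- I) nth 0 s i <= top_sum s k.
Proof.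
move=> ks s0 uI Is Ik.
have [k0|k0] := posnP k.
  by move: Ik; rewrite k0 leqn0 size_eq0 => /eqP ->; rewrite big_nil /top_sum
    subn0 big_geq.
have nk : (size s - k < size s)%N by lia.
pose c := nth 0 (sort <=%R s) (size s - k).
pose p (y : R) := Num.max (y - c) 0.
have szs : size (sort <=%R s) = size s by rewrite size_sort.
have srt i j : (i <= j < size s)%N -> nth 0 (sort <=%R s) i <= nth 0 (sort <=%R s) j.
  move=> /andP[ij js]; apply: (sorted_leq_nth (@le_trans _ R) (@le_refl _ R)) => //.
  - exact: sort_le_sorted.
  - by rewrite inE szs; lia.
  - by rewrite inE szs.
have c0 : 0 <= c by apply: s0; rewrite -(mem_sort <=%R) mem_nth // szs.
have sumI : \sum_(i <- I) p (nth 0 s i) <= \sum_(y <- s) p y.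
  have -> : \sum_(y <- s) p y = \sum_(i <- iota 0 (size s)) p (nth 0 s i).
    by rewrite (big_nth 0) /index_iota subn0.
  have pI : perm_eq I [seq i <- iota 0 (size s) | i \in I].
    apply: uniq_perm => //; first by rewrite filter_uniq // iota_uniq.
    move=> i; rewrite mem_filter mem_iota add0n; case: (boolP (i \in I)) => //= iI.
    by rewrite (allP Is _ iI).
  rewrite (perm_big _ pI) big_filter big_mkcond /=; apply: ler_sum => i _.
  by case: ifP => // _; rewrite /p le_max lexx orbT.
have top : \sum_(y <- s) p y = top_sum s k - k%:R * c.
  have -> : \sum_(y <- s) p y = \sum_(y <- sort <=%R s) p y.
    by apply: perm_big; rewrite perm_sym perm_sort.
  rewrite (big_nth 0) szs (big_cat_nat _ (n := size s - k)) ?leq_subr //=.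
  rewrite big_nat big1 ?add0r; last first.
    move=> i /andP[_ ik]; rewrite /p; apply/max_idPr; rewrite subr_le0 srt //.
    by rewrite (ltnW ik) nk.
  rewrite big_nat (eq_bigr (fun i => nth 0 (sort <=%R s) i - c)); last first.
    move=> i /andP[ki ik]; apply/max_idPl; rewrite subr_ge0 srt // ki.
    by [].
  rewrite -big_nat sumrB /top_sum sumr_const_nat subKn //.
  by rewrite mulr_natl.
apply: (@le_trans _ _ (\sum_(i <- I) (c + p (nth 0 s i)))).
  apply: ler_sum => i _; have : nth 0 s i - c <= p (nth 0 s i).
    by rewrite /p le_max lexx.
  lra.
rewrite big_split /= big_const_seq count_predT iter_addr_0.
have : c *+ size I <= k%:R * c.
  by rewrite -[c *+ _]mulr_natl ler_wpM2r // ler_nat.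
by move: sumI; rewrite top; lra.
Qed.

Lemma top_sum_attained s k : (k <= size s)%N ->
  exists I : seq nat, [/\ uniq I, all (fun i => i < size s)%N I, size I = k &
    top_sum s k = \sum_(i <- I) nth 0 s i].
Proof.
move=> ks; have [J pJ sJ] := perm_iota_sort <=%R 0 s.
have szJ : size J = size s by rewrite (perm_size pJ) size_iota.
exists (drop (size s - k) J); split.
- by rewrite drop_uniq // (perm_uniq pJ) iota_uniq.
- apply/allP => i /mem_drop; rewrite (perm_mem pJ) mem_iota add0n.
  by case/andP.
- by rewrite size_drop szJ subKn.
rewrite /top_sum sJ [RHS](big_nth 0%N) size_drop szJ subKn //.
rewrite -{1}[(size s - k)%N]add0n big_addn subKn // !big_nat.
apply: eq_bigr => i /andP[_ ik].
by rewrite (nth_map 0%N) ?nth_drop ?szJ 1?addnC //; lia.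
Qed.

(** Existence over finite index sets serves twice: it accepts the jumps collected by
    [not_completes_bound], and it presents the event as a countable union, hence as a measurable
    set. *)
Lemma gt_top_sum s k c : (k <= size s)%N -> (forall y, y \in s -> 0 <= y) ->
  (c < top_sum s k) <-> exists I : seq nat,
    [/\ uniq I, all (fun i => i < size s)%N I, (size I <= k)%N &
      c < \sum_(i <- I) nth 0 s i].
Proof.
move=> ks s0; split => [h|[I [uI Is Ik h]]].
  have [I [uI Is Ik E]] := top_sum_attained ks.
  by exists I; rewrite -E Ik.
exact: lt_le_trans h (sum_le_top_sum ks s0 uI Is Ik).
Qed.

Lemma gt_maxdist m (y : nat -> 'M[R]_m) n c : 0 <= c ->
  (c < maxdist y n) <-> exists2 j, (j < n)%N & c < dR 1%:M (y j).
Proof.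
move=> c0; rewrite /maxdist.
have max_seq (r : seq nat) : (c < \big[Order.max/0]_(j <- r) dR 1%:M (y j)) <->
    exists2 j, j \in r & c < dR 1%:M (y j).
  elim: r => [|i r IHr]; first by rewrite big_nil; split => [|[j]//]; rewrite ltNge c0.
  rewrite big_cons lt_max; split => [/orP[h|/IHr[j jr h]]|[j]].
  - by exists i => //; exact: mem_head.
  - by exists j => //; rewrite inE jr orbT.
  rewrite inE => /orP[/eqP -> -> //|jr h].
  by apply/orP; right; apply/IHr; exists j.
apply: iff_trans (max_seq _) _; split => -[j jn h]; exists j => //.
  by move: jn; rewrite mem_index_iota.
by rewrite mem_index_iota.
Qed.

End OrderStatistics.

(** * The tail bound for the walk *)

Section Assembly.
Context (R : realType) (d : measure_display) (T : measurableType d)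
  (P : probability T R) (m : nat).
Variable X : nat -> {RV P >-> borelmx R m}.
Variables (n l : nat) (n_ : nat -> nat) (t : nat -> R).
Hypothesis XP : forall i w, posdefmx (X i w : 'M[R]_m).
Hypothesis X_indep : mutually_independent X.
Hypothesis X_orth : forall i, orthogonally_invariant (X i).
Hypothesis l_ge1 : (1 <= l)%N.
Hypothesis n_ge1 : forall i, (1 <= i <= l)%N -> (1 <= n_ i)%N.
Hypothesis t_ge0 : forall i, (i <= l)%N -> 0 <= t i.

Let Y i w : 'M[R]_m := X i w.
Let x w i : 'M[R]_m := X i w.
Let D i j w := gap (x w) i j.
Let SF k := cylinder Y 0 k.
Let SG k := future_cylinder (fun i w => rotated (x w) i) k.

Let xP w i : posdefmx (x w i). Proof. exact: XP. Qed.

Let mY i : mxmeas (Y i).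
Proof. exact: mxmeas_RV. Qed.

Let mrot i : mxmeas (fun w => rotated (x w) i).
Proof. by apply: mxmeas_rotated => [w q|q _]; [exact: XP|exact: mY]. Qed.

Let SF_sub k A : <<s SF k >> A -> measurable A.
Proof.
by apply: sigma_sub_measurable; apply: cylinder_measurable => i _; exact: mY.
Qed.

Let SG_sub k A : <<s SG k >> A -> measurable A.
Proof.
apply: sigma_sub_measurable => S [b _]; apply: cylinder_measurable => i _.
exact: mrot.
Qed.

Let D_SF i j k : (i <= j <= k)%N ->
  measurable_fun [set: g_sigma_algebraType (SF k)] (D i j).
Proof.
move=> ijk; apply: (@measurable_gap_past _ _ _ (g_sigma_algebraType (SF k)) x) => //.
  exact: ijk.
by move=> q qk; apply: (@mxmeas_cylinder _ _ _ Y _ 0 k).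
Qed.

Let D_SG i j k : (k <= i <= j)%N ->
  measurable_fun [set: g_sigma_algebraType (SG k)] (D i j).
Proof.
move=> kij; apply: (@measurable_gap_future _ _ _ (g_sigma_algebraType (SG k)) x) => //.
  exact: kij.
move=> q kq; apply: (@mxmeas_cylinder _ _ _ (fun i w => rotated (x w) i) _ k q.+1).
  by rewrite kq /=.
by move=> S cS; exists q.+1.
Qed.

Let indep k A B : <<s SF k >> A -> <<s SG k >> B ->
  Pr P (A `&` B) = Pr P A * Pr P B.
Proof. exact: past_future_indep. Qed.

Let D_ge0 i j w : 0 <= D i j w. Proof. exact: gap_ge0. Qed.
Let Dii i w : D i i w = 0. Proof. exact: gapii. Qed.
Let DC i j w : D i j w = D j i w. Proof. exact: gapC. Qed.
Let D_triangle i j k w : D i k w <= D i j w + D j k w.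
Proof. exact: gap_triangle. Qed.

Let mD i j : measurable_fun [set: T] (D i j).
Proof.
apply: measurable_mxlen => [w|]; first by rewrite unitmx_mul unitmx_inv !frame_unit.
apply: mxmeasM; last by apply: mxmeas_frame => // q _; exact: mY.
apply: mxmeasV => [w|]; first exact: frame_unit.
by apply: mxmeas_frame => // q _; exact: mY.
Qed.

Let hitE c : 0 <= c -> hit D 0 n c = [set w | c < maxdist (walk (x w)) n].
Proof.
move=> c0; apply/seteqP; split => w /=.
  move=> [j /andP[j0 jn]]; rewrite /D -(prednK j0) (gap0 (xP w)) => h.
  by apply/(gt_maxdist _ _ c0); exists j.-1; rewrite ?prednK.
move=> /(gt_maxdist _ _ c0) [j jn h]; exists j.+1; first by rewrite jn.
by rewrite /D (gap0 (xP w)).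
Qed.

Let mU c : 0 <= c -> measurable [set w | c < maxdist (walk (x w)) n].
Proof.
by move=> c0; rewrite -hitE //; apply: measurable_hit => j _; exact: mD.
Qed.

Let dists_size w : size (dists (x w) n) = n.
Proof. by rewrite size_map size_iota. Qed.

Let dists_nth w i : (i < n)%N -> nth 0 (dists (x w) n) i = D i i.+1 w.
Proof.
move=> iN; rewrite /D (gap_succ (xP w)) /dists (nth_map 0%N) ?size_iota.
  by rewrite nth_iota ?add0n.
exact: iN.
Qed.

Let dists_ge0 w y : y \in dists (x w) n -> 0 <= y.
Proof. by move=> /mapP [j _ ->]; exact: dR1_ge0. Qed.

Let mtop k c : (k <= n)%N -> measurable [set w | c < top_sum (dists (x w) n) k].
Proof.
move=> kn; pose F (J : seq nat) : set T :=
  if [&& uniq J, all (fun i => i < n)%N J & (size J <= k)%N]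
  then [set w | c < \sum_(i <- J) D i i.+1 w] else set0.
rewrite (_ : mkset _ = \bigcup_J F J).
  apply: countable_bigcupT_measurable => [|J]; first exact: countableP.
  rewrite /F; case: ifP => // _; apply: measurable_gt_fun.
  by apply: measurable_sum => i; exact: mD.
have E (J : seq nat) w : all (fun i => i < n)%N J ->
    \sum_(i <- J) D i i.+1 w = \sum_(i <- J) nth 0 (dists (x w) n) i.
  move=> /allP Jn; rewrite !big_seq; apply: eq_bigr => i /Jn iN.
  by rewrite dists_nth.
apply/seteqP; split => w /=.
  have ks : (k <= size (dists (x w) n))%N by rewrite dists_size.
  move=> /(gt_top_sum _ ks (@dists_ge0 w)) [J [uJ Jn Jk h]]; exists J => //.
  by rewrite dists_size in Jn; rewrite /F uJ Jn Jk /= E.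
have ks : (k <= size (dists (x w) n))%N by rewrite dists_size.
move=> [J _]; rewrite /F; case: ifP => [/and3P[uJ Jn Jk]|_ []] /=.
rewrite (E _ _ Jn) => h; apply/(gt_top_sum _ ks (@dists_ge0 w)); exists J.
by rewrite dists_size.
Qed.

Let mM c : 0 <= c -> measurable [set w | c < maxdist (x w) n].
Proof.
move=> c0; rewrite (_ : mkset _ =
    \bigcup_(j in [set j | (j < n)%N]) [set w | c < D j j.+1 w]).
  by apply: bigcup_measurable => j _; apply: measurable_gt_fun; exact: mD.
apply/seteqP; split => w /=.
  move=> /(gt_maxdist _ _ c0) [j jn h]; exists j; first exact: jn.
  by rewrite /= /D (gap_succ (xP w)).
move=> [j /= jn]; rewrite /D (gap_succ (xP w)) => h.
by apply/(gt_maxdist _ _ c0); exists j; [exact: jn|exact: h].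
Qed.

Let top_sum_maxdist w k : (k <= n)%N ->
  top_sum (dists (x w) n) k <= k%:R * maxdist (x w) n.
Proof.
move=> kn; have ks : (k <= size (dists (x w) n))%N by rewrite dists_size.
have [J [_ Jn sJ ->]] := top_sum_attained ks.
rewrite -sJ mulr_natl -[_ *+ _]addr0 -iter_addr -(count_predT J) -big_const_seq.
rewrite !big_seq; apply: ler_sum => j jJ.
have jn : (j < n)%N by have := allP Jn j jJ; rewrite dists_size.
rewrite dists_nth // leNgt; apply/negP => h.
have M0 : 0 <= maxdist (x w) n by apply: bigmax_ge_id.
have : maxdist (x w) n < maxdist (x w) n.
  apply/(gt_maxdist _ _ M0); exists j; first exact: jn.
  by rewrite -(gap_succ (xP w)).
by rewrite ltxx.
Qed.

Let nb : nat := (\sum_(1 <= i < l.+1) n_ i)%N.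
Let js := index_iota 2 l.+1.
Let thresholds : seq R := t 1%N :: nseq (n_ 1%N).-1 (2 * t 1%N) ++
  flatten [seq nseq (n_ j) (2 * t j) | j <- js].

Let index_cons : index_iota 1 l.+1 = 1%N :: js.
Proof. by rewrite /js /index_iota; case: (l) l_ge1 => // k _; rewrite !subSS !subn0. Qed.

Let n1 : (0 < n_ 1)%N. Proof. by apply: n_ge1; rewrite l_ge1. Qed.

Let sum_thresholds : \sum_(a <- thresholds) a =
  (2 * (n_ 1%N)%:R - 1) * t 1%N + 2 * \sum_(2 <= j < l.+1) (n_ j)%:R * t j.
Proof.
rewrite big_cons big_cat /= big_nseq iter_addr_0 addrA; congr (_ + _).
  by rewrite -mulr_natr -(prednK n1) /= -[in RHS]natr1; ring.
rewrite big_flatten big_map mulr_sumr; apply: eq_bigr => j _.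
by rewrite big_nseq iter_addr_0 -mulr_natr; ring.
Qed.

Let size_thresholds : size thresholds = nb.
Proof.
rewrite /nb index_cons big_cons /= size_cat size_nseq -addSn prednK //.
congr (_ + _)%N; rewrite size_flatten /shape -map_comp sumnE big_map.
by apply: eq_bigr => j _; rewrite /= size_nseq.
Qed.

Let thresholds_ge0 : all (fun a => 0 <= a) thresholds.
Proof.
have t1 : 0 <= t 1%N by exact: t_ge0.
rewrite /= t1 all_cat /=; apply/andP; split.
  by apply/allP => a /nseqP [-> _]; rewrite mulr_ge0.
apply/allP => a /flattenP [s /mapP[j jl ->] /nseqP[-> _]].
rewrite mulr_ge0 // t_ge0 //; move: jl; rewrite mem_index_iota; lia.
Qed.

Let c_tail := (nb%:R - 1) * t 0%N + \sum_(a <- thresholds) a.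

Let nb_gt0 : (0 < nb)%N. Proof. by rewrite -size_thresholds. Qed.

Let c_tail_ge0 : 0 <= c_tail.
Proof.
rewrite addr_ge0 ?mulr_ge0 ?t_ge0 ?subr_ge0 ?ler1n //.
by rewrite big_seq; apply: sumr_ge0 => a /(allP thresholds_ge0).
Qed.

Let tail_sub : (nb <= n.+1)%N -> [set w | c_tail < maxdist (walk (x w)) n] `<=`
  [set w | (nb%:R - 1) * t 0%N < top_sum (dists (x w) n) nb.-1] `|`
  completes D n 0 thresholds.
Proof.
move=> nbn w; rewrite -hitE // => -[j jn Dj].
have [h|nc] := pselect (completes D n 0 thresholds w); [by right|left => /=].
have [I [uI In sI DI]] :=
  not_completes_bound D_ge0 Dii D_triangle (leq0n n) thresholds_ge0 nc.
(* This is where the bound on n_bullet enters: n_bullet - 1 distinct jumps have to fit among [n]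
   steps. *)
have ks : (nb.-1 <= size (dists (x w) n))%N by rewrite dists_size; lia.
have In' : all (fun i => i < n)%N I by apply: sub_all In => i.
apply/(gt_top_sum _ ks (@dists_ge0 w)); exists I; rewrite dists_size.
split => //; first by rewrite -size_thresholds.
have <- : \sum_(i <- I) D i i.+1 w = \sum_(i <- I) nth 0 (dists (x w) n) i.
  by rewrite !big_seq; apply: eq_bigr => i /(allP In') iN; rewrite dists_nth.
have := DI j; rewrite /= (_ : (j <= n)%N); last by lia.
by move=> /(_ isT); move: Dj; rewrite /c_tail; lra.
Qed.

Local Notation u j := (Pr P (hit D 0 n (t j))).

Let I0 : pred nat := fun i =>
  (1 - u i) ^+ (n_ i - (i == 1))%N <= 1 / ((n_ i)`!)%:R.

(** Keeps the denominators outside I_0 positive. If [1 - u j] were 0, the test defining [I0] would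
    read 0 <= 1 / n_j!, or 1 <= 1 / 1! through 0^0 = 1 when [j] and [n_ 1] are both 1, and it would
    succeed. *)
Let notI0 j : (1 <= j <= l)%N -> ~~ I0 j -> 0 < 1 - u j.
Proof.
move=> jl; have nj := n_ge1 jl; apply: contraNT; rewrite -leNgt => uj.
have u1 : 1 - u j = 0.
  apply/eqP; rewrite eq_le uj subr_ge0 /=; apply: Pr_le1.
  by apply: measurable_hit => i _; exact: mD.
rewrite /I0 u1 expr0n; case: eqP => [/eqP|_]; last by rewrite div1r invr_ge0.
rewrite subn_eq0; case: (eqVneq j 1%N) => [->|_] /= h; last by lia.
have -> : n_ 1%N = 1%N by have := n1; lia.
by rewrite (_ : 1`! = 1)%N ?divr1.
Qed.

Let remainder : R :=
  (1 - u 1%N) ^+ (~~ I0 1%N)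
  * (\prod_(1 <= j < l.+1 | I0 j) u j ^+ n_ j)
  * (\prod_(1 <= j < l.+1 | ~~ I0 j)
       (1 / ((n_ j)`!)%:R * (u j / (1 - u j)) ^+ n_ j)).

Let completes_le : Pr P (completes D n 0 thresholds) <= remainder.
Proof.
have jsP j : j \in 1%N :: js -> (1 <= j <= l)%N.
  by rewrite -index_cons mem_index_iota.
apply: le_trans (completes_all_blocks Dii DC D_triangle SF_sub SG_sub D_SF D_SG
  indep (small := I0) n1 _ _) _.
- by move=> j /jsP jl; apply: t_ge0; lia.
- by move=> j /jsP; exact: notI0.
rewrite /remainder -mulrA le_eqVlt; apply/orP; left; apply/eqP.
rewrite -index_cons [in LHS](bigID I0) /=; congr (_ * (_ * _)).
  by apply: eq_bigr => j ->.
by apply: eq_bigr => j /negbTE ->.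
Qed.

Let U w := maxdist (walk (x w)) n.

Let Pr_gt j : (j <= l)%N -> Pr P [set w | U w > t j] = u j.
Proof. by move=> jl; rewrite hitE ?t_ge0. Qed.

Let Pr_le_U j : (j <= l)%N -> Pr P [set w | U w <= t j] = 1 - u j.
Proof.
move=> jl; rewrite -Pr_gt // -Pr_setC; last exact/mU/t_ge0.
congr Pr; apply/seteqP; split => w /=; rewrite leNgt; first by move/negP.
by move=> h; apply/negP.
Qed.

Let remainder_U : R :=
  let small : pred nat := fun i =>
    (Pr P [set w | U w <= t i]) ^+ (n_ i - (i == 1))%N <= 1 / ((n_ i)`!)%:R in
  (Pr P [set w | U w <= t 1%N]) ^+ (~~ small 1%N)
  * (\prod_(1 <= j < l.+1 | small j) (Pr P [set w | U w > t j]) ^+ n_ j)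
  * (\prod_(1 <= j < l.+1 | ~~ small j)
       (1 / ((n_ j)`!)%:R
        * (Pr P [set w | U w > t j] / Pr P [set w | U w <= t j]) ^+ n_ j)).

Let remainder_UE : remainder_U = remainder.
Proof.
rewrite /remainder_U /remainder /I0 /=.
congr (_ * _ * _); first by rewrite Pr_le_U.
  rewrite big_nat_cond [RHS]big_nat_cond; apply: eq_big => j.
    by case: (boolP (1 <= j < l.+1)%N) => //= jl; rewrite Pr_le_U //; lia.
  by move=> /andP[jl _]; rewrite Pr_gt //; lia.
rewrite big_nat_cond [RHS]big_nat_cond; apply: eq_big => j.
  by case: (boolP (1 <= j < l.+1)%N) => //= jl; rewrite Pr_le_U //; lia.
by move=> /andP[jl _]; rewrite Pr_gt ?Pr_le_U //; lia.
Qed.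

Lemma hoffmann_jorgensen_top_sum : (nb <= n.+1)%N ->
  Pr P [set w | U w > (nb%:R - 1) * t 0%N + (2 * (n_ 1%N)%:R - 1) * t 1%N
                      + 2 * \sum_(2 <= j < l.+1) (n_ j)%:R * t j] <=
  Pr P [set w | top_sum (dists (x w) n) nb.-1 > (nb%:R - 1) * t 0%N] + remainder_U.
Proof.
move=> nbn; have mA : measurable
    [set w | (nb%:R - 1) * t 0%N < top_sum (dists (x w) n) nb.-1].
  by apply: mtop; lia.
have mC : measurable (completes D n 0 thresholds).
  by apply: measurable_completes => i j _; exact: mD.
rewrite -addrA -sum_thresholds remainder_UE.
apply: le_trans (_ : Pr P (_ `|` _) <= _).
  apply: Pr_le; [exact: mU| |exact: (tail_sub nbn)]; exact: measurableU.
by apply: le_trans (Pr_setU_le _ mA mC) _; rewrite lerD2l.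
Qed.

(** Derives the first inequality of the theorem from the strengthened one: if the [nb.-1] largest
    distances sum to more than [nb.-1] times [t 0], one of them exceeds [t 0]. *)
Lemma top_sum_le_maxdist : (nb <= n.+1)%N ->
  Pr P [set w | top_sum (dists (x w) n) nb.-1 > (nb%:R - 1) * t 0%N] <=
  Pr P [set w | maxdist (x w) n > t 0%N].
Proof.
move=> nbn; have kn : (nb.-1 <= n)%N by lia.
apply: Pr_le; [exact: mtop|exact/mM/t_ge0|move=> w /= h].
have E : nb%:R - 1 = nb.-1%:R :> R by rewrite -(prednK nb_gt0) -natr1 addrK.
rewrite ltNge; apply/negP => Mt.
have := top_sum_maxdist w kn; rewrite leNgt => /negP; apply.
by apply: le_lt_trans h; rewrite E ler_wpM2l.
Qed.

End Assembly.

(** Order statistics are numbered from 1 and positions in the sorted list from 0; the range has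
    [k.-1] terms, one for each jump that can be charged. *)
Lemma sum_order_stat (R : realType) (s : seq R) k : (0 < k <= (size s).+1)%N ->
  \sum_((size s).+2 - k <= j < (size s).+1) order_stat s j = top_sum s k.-1.
Proof.
move=> /andP[k0 ks]; rewrite subSn ?big_add1 //= /top_sum.
by have -> : ((size s).+1 - k = size s - k.-1)%N by lia.
Qed.

Theorem theorem3p1 (R : realType) (d : measure_display) (T : measurableType d)
    (P : probability T R) (m : nat) (X : nat -> {RV P >-> borelmx R m})
    (n l : nat) (n_ : nat -> nat) (t : nat -> R) :
  (1 <= m)%N ->
  (forall i w, posdefmx (X i w : 'M[R]_m)) ->
  mutually_independent X ->
  identically_distributed X ->
  (forall i, orthogonally_invariant (X i)) ->
  (1 <= n)%N ->
  (1 <= l)%N ->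
  (forall i, (1 <= i <= l)%N -> (1 <= n_ i)%N) ->
  (forall i, (i <= l)%N -> 0 <= t i) ->
  let x (w : T) (i : nat) : 'M[R]_m := X i w in
  let M (w : T) : R := maxdist (x w) n in
  let U (w : T) : R := maxdist (walk (x w)) n in
  let Y (w : T) (j : nat) : R := order_stat (dists (x w) n) j in
  let nbullet : nat := (\sum_(1 <= i < l.+1) n_ i)%N in
  let I0 : pred nat := fun i =>
    (Pr P [set w | U w <= t i]) ^+ (n_ i - (i == 1))%N <= 1 / ((n_ i)`!)%:R in
  let tail : R :=
    Pr P [set w | U w > (nbullet%:R - 1) * t 0%N
                        + (2 * (n_ 1%N)%:R - 1) * t 1%N
                        + 2 * \sum_(2 <= j < l.+1) (n_ j)%:R * t j] in
  let remainder : R :=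
    (Pr P [set w | U w <= t 1%N]) ^+ (~~ I0 1%N)
    * (\prod_(1 <= j < l.+1 | I0 j) (Pr P [set w | U w > t j]) ^+ n_ j)
    * (\prod_(1 <= j < l.+1 | ~~ I0 j)
         (1 / ((n_ j)`!)%:R
          * (Pr P [set w | U w > t j] / Pr P [set w | U w <= t j]) ^+ n_ j)) in
  (nbullet <= n.+1)%N ->
  tail <= Pr P [set w | M w > t 0%N] + remainder
  /\
  tail <= Pr P [set w | \sum_(n.+2 - nbullet <= j < n.+1) Y w j
                        > (nbullet%:R - 1) * t 0%N] + remainder.
Proof.
move=> m1 XP X_indep X_id X_orth n1 l1 n_ge1 t_ge0 x M U Y nbullet I0 tail
  remainder nbn.
have nb0 : (0 < nbullet)%N.
  by rewrite /nbullet big_ltn ?ltnS // addn_gt0 n_ge1.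
have Ytop w : \sum_(n.+2 - nbullet <= j < n.+1) Y w j =
    top_sum (dists (x w) n) nbullet.-1.
  have szn : size (dists (x w) n) = n by rewrite size_map size_iota.
  by rewrite -[in LHS]szn sum_order_stat // szn nb0.
have strong := hoffmann_jorgensen_top_sum XP X_indep X_orth l1 n_ge1 t_ge0 nbn.
have weak := top_sum_le_maxdist XP X_indep X_orth l1 n_ge1 t_ge0 nbn.
split; first by apply: le_trans strong _; rewrite lerD2r.
by under eq_set do rewrite Ytop.
Qed.
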